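(* Let $\mathbf n=(n_1,\ldots,n_k)\in\mathbb N^k$ with $n_i\ge2$ for all $i$. Let $\mathcal M$ be a (closed) invariant subspace of $F^2(H_{n_1})\otimes\cdots\otimes F^2(H_{n_k})\otimes\mathcal E$, where $\mathcal E$ is a finite dimensional Hilbert space. Then the Euler characteristic of $\mathcal M^\perp$, i.e. the iterated limit $$\chi(\mathcal M^\perp):=\lim_{q_1\to\infty}\cdots\lim_{q_k\to\infty}\frac{\mathrm{rank}\left[P_{\mathcal M^\perp}(P_{\le(q_1,\ldots,q_k)}\otimes I_{\mathcal E})\right]}{\mathrm{rank}\left[P_{\le(q_1,\ldots,q_k)}\right]},$$ exists and satisfies $$\chi(\mathcal M^\perp)=\chi(\mathbf M),$$ where $\mathbf M:=(M_1,\ldots,M_k)$ with $M_i:=(M_{i,1},\ldots,M_{i,n_i})$ and $M_{i,j}:=P_{\mathcal M^\perp}(\mathbf S_{i,j}\otimes I_{\mathcal E})|_{\mathcal M^\perp}$.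
   Context: $H_{n_i}$ is an $n_i$-dimensional complex Hilbert space with orthonormal basis $e^i_1,\ldots,e^i_{n_i}$, and $F^2(H_{n_i}):=\mathbb C1\oplus\bigoplus_{p\ge1}H_{n_i}^{\otimes p}$ has orthonormal basis $e^i_\alpha:=e^i_{j_1}\otimes\cdots\otimes e^i_{j_p}$ for words $\alpha=g^i_{j_1}\cdots g^i_{j_p}$ in the unital free semigroup $\mathbb F_{n_i}^+$ on generators $g^i_1,\ldots,g^i_{n_i}$ (with $e^i_{g^i_0}:=1$ for the identity $g_0^i$); $|\alpha|$ is word length. $S_{i,j}e^i_\alpha:=e^i_{g^i_j\alpha}$ on $F^2(H_{n_i})$; $\mathbf S_{i,j}$ acts on $\bigotimes_{i=1}^kF^2(H_{n_i})$ as $S_{i,j}$ on the $i$-th factor and the identity on the others. Invariant means invariant under each $\mathbf S_{i,j}\otimes I_{\mathcal E}$. $P_{\le(q_1,\ldots,q_k)}$ is the orthogonal projection of $\bigotimes_{i=1}^kF^2(H_{n_i})$ onto the span of $e^1_{\alpha_1}\otimes\cdots\otimes e^k_{\alpha_k}$ with $|\alpha_i|\le q_i$; $P_{\mathcal M^\perp}$ is the orthogonal projection onto $\mathcal M^\perp$. Euler characteristic of a tuple: for $\mathbf T=(T_1,\ldots,T_k)$, $T_i=(T_{i,1},\ldots,T_{i,n_i})$, of bounded operators on a Hilbert space $\mathcal G$ with entries of $T_s$ commuting with entries of $T_t$ for $s\ne t$, let $\Phi_{T_i}(Y):=\sum_jT_{i,j}YT_{i,j}^*$ and $\mathbf\Delta_{\mathbf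 T}(I):=(id-\Phi_{T_1})\circ\cdots\circ(id-\Phi_{T_k})(I)$, assumed of finite rank. With $T_{i,\alpha}:=T_{i,j_1}\cdots T_{i,j_p}$ for $\alpha=g^i_{j_1}\cdots g^i_{j_p}$, $T_{i,g_0^i}:=I$, let $M_{\mathbf q}(\mathbf T):=\mathrm{span}\{T_{1,\alpha_1}\cdots T_{k,\alpha_k}h:|\alpha_i|\le q_i,\ h\in\mathbf\Delta_{\mathbf T}(I)(\mathcal G)\}$ for $\mathbf q\in\mathbb Z_+^k$. Then $$\chi(\mathbf T):=\lim_{m\to\infty}\frac{\dim M_{\mathbf q^{(m)}}(\mathbf T)}{\prod_{i=1}^k(1+n_i+\cdots+n_i^{q_i^{(m)}})}$$ for any increasing cofinal sequence $\mathbf q^{(m)}$ in $\mathbb Z_+^k$ (when all $n_i\ge2$ the limit exists and is independent of the sequence). *)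

(* Defs.v *)
From HB Require Import structures.
From mathcomp Require Import all_boot all_order all_algebra.
From mathcomp Require Import sesquilinear.
From mathcomp.real_closed Require Import complex.
From mathcomp Require Import all_classical all_reals all_analysis.
From mathcomp Require Import lra.

Set Implicit Arguments.
Unset Strict Implicit.
Unset Printing Implicit Defensive.

Import Order.TTheory GRing.Theory Num.Theory.
Import numFieldNormedType.Exports.

Local Open Scope classical_set_scope.
Local Open Scope ring_scope.
Local Open Scope complex_scope.

(* Unconditional sums over an arbitrary index type; meaningful only for
   (absolutely) summable families. *)
Definition nsum (R : realType) (I : choiceType) (g : I -> R) : R :=
  fine (\esum_(i in [set: I]) (g i)%:E).

Definition rsum (R : realType) (I : choiceType) (f : I -> R) : R :=
  nsum (fun i => Num.max (f i) 0) - nsum (fun i => Num.max (- f i) 0).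

Definition csum (R : realType) (I : choiceType) (f : I -> R[i]) : R[i] :=
  rsum (fun i => complex.Re (f i)) +i* rsum (fun i => complex.Im (f i)).

Section SumTheory.
Context {R : realType} {I : choiceType}.
Implicit Types f g h : I -> R.

Definition rsummable f := summable [set: I] (fun i => (f i)%:E).

Lemma rsummable_le f g : (forall i, `|f i| <= g i) -> rsummable g -> rsummable f.
Proof.
move=> fg; apply: le_lt_trans; apply: le_esum => i _ /=.
by rewrite lee_fin (le_trans (fg i))// ler_norm.
Qed.

Lemma rsummableD f g : rsummable f -> rsummable g ->
  rsummable (fun i => f i + g i).
Proof. by move=> /summableD sf /sf. Qed.

Lemma nsum_fin g : (forall i, 0 <= g i) -> rsummable g ->
  (\esum_(i in [set: I]) (g i)%:E = (nsum g)%:E)%E.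
Proof.
move=> g0 sg; rewrite /nsum fineK//.
have -> : (\esum_(i in [set: I]) (g i)%:E = \esum_(i in [set: I]) `|(g i)%:E|)%E.
  by apply: eq_esum => i _ /=; rewrite ger0_norm.
by rewrite -summableE.
Qed.

Lemma nsumD g h : (forall i, 0 <= g i) -> (forall i, 0 <= h i) ->
  rsummable g -> rsummable h -> nsum (fun i => g i + h i) = nsum g + nsum h.
Proof.
move=> g0 h0 sg sh.
rewrite {1}/nsum (eq_esum (fun i _ => EFinD (g i) (h i))).
rewrite esumD; [|by move=> i _; rewrite lee_fin..].
by rewrite !nsum_fin.
Qed.

Lemma rsum_decomp f g h : (forall i, 0 <= g i) -> (forall i, 0 <= h i) ->
  rsummable g -> rsummable h -> (forall i, f i = g i - h i) ->
  rsum f = nsum g - nsum h.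
Proof.
move=> g0 h0 sg sh fE.
have sgh : rsummable (fun i => g i + h i) by exact: rsummableD.
have m0 f' i : 0 <= Num.max (f' i : R) 0 by rewrite le_max lexx orbT.
have sp : rsummable (fun i => Num.max (f i) 0).
  apply: rsummable_le sgh => i; rewrite ger0_norm ?m0// fE ge_max addr_ge0// andbT.
  by rewrite lerD2l (le_trans _ (h0 i))// oppr_le0.
have sn : rsummable (fun i => Num.max (- f i) 0).
  apply: rsummable_le sgh => i.
  rewrite ger0_norm ?le_max ?lexx ?orbT// fE ge_max addr_ge0// andbT.
  by rewrite opprB addrC lerD2r (le_trans _ (g0 i))// oppr_le0.
apply/eqP; rewrite /rsum subr_eq addrAC eq_sym subr_eq; apply/eqP.
rewrite -!nsumD//; last by move=> i; rewrite le_max lexx orbT.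
congr nsum; apply/funext => i.
have -> : Num.max (f i) 0 = Num.max (- f i) 0 + f i.
  by rewrite addr_maxl addNr add0r maxC.
by rewrite -addrA fE subrK addrC.
Qed.

Let pos f i := Num.max (f i) 0.

Let pos_ge0 f i : 0 <= pos f i. Proof. by rewrite le_max lexx orbT. Qed.

Let posB f i : f i = pos f i - pos (fun i => - f i) i.
Proof.
have := pos_ge0 f i; rewrite /pos.
by case: (leP (f i) 0) => f0 _; case: (leP (- f i) 0) => f1;
  rewrite ?opprK ?subr0 ?add0r//; move: f0 f1; lra.
Qed.

Let pos_sum f : rsummable f -> rsummable (pos f).
Proof.
move=> sf; apply: (@rsummable_le _ (fun i => `|f i|)).
  by move=> i; rewrite ger0_norm ?pos_ge0// ge_max ler_norm normr_ge0.
apply: le_lt_trans sf; apply: le_esum => i _ /=.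
by rewrite normr_id.
Qed.

Lemma rsummableN f : rsummable f -> rsummable (fun i => - f i).
Proof. by rewrite /rsummable summableN. Qed.

Lemma rsumD f g : rsummable f -> rsummable g ->
  rsum (fun i => f i + g i) = rsum f + rsum g.
Proof.
move=> sf sg; have sNf := rsummableN sf; have sNg := rsummableN sg.
rewrite (@rsum_decomp _ (fun i => pos f i + pos g i)
  (fun i => pos (fun i => - f i) i + pos (fun i => - g i) i)).
- by rewrite !nsumD ?pos_sum// /rsum opprD addrACA.
- by move=> i; rewrite addr_ge0.
- by move=> i; rewrite addr_ge0.
- by apply: rsummableD; exact: pos_sum.
- by apply: rsummableD; exact: pos_sum.
- by move=> i; rewrite {1}(posB f) {1}(posB g) opprD addrACA.
Qed.

Lemma esumZ (c : R) g : 0 <= c -> (forall i, 0 <= g i) ->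
  (\esum_(i in [set: I]) (c * g i)%:E = c%:E * \esum_(i in [set: I]) (g i)%:E)%E.
Proof.
move=> c0 g0; rewrite /esum -ereal_supZl//; last first.
  by apply/set0P; exists 0%E, set0; [exact: fsets_set0|rewrite fsbig_set0].
congr ereal_sup; rewrite image_comp; apply: eq_imagel => X _ /=.
rewrite (eq_fsbigr (fun i => c%:E * (g i)%:E)%E); last by move=> i _; rewrite EFinM.
by rewrite ge0_mule_fsumr// => i; rewrite lee_fin.
Qed.

Lemma rsummableZ (c : R) f : rsummable f -> rsummable (fun i => c * f i).
Proof.
move=> sf; rewrite /rsummable /summable.
rewrite (eq_esum (b := fun i => (`|c| * `|f i|)%:E)); last first.
  by move=> i _ /=; rewrite normrM.
by rewrite esumZ// lte_mul_pinfty// lee_fin.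
Qed.

Lemma nsumZ (c : R) g : 0 <= c -> (forall i, 0 <= g i) -> rsummable g ->
  nsum (fun i => c * g i) = c * nsum g.
Proof. by move=> c0 g0 sg; rewrite /nsum esumZ// nsum_fin// -EFinM. Qed.

Lemma rsumZ (c : R) f : rsummable f -> rsum (fun i => c * f i) = c * rsum f.
Proof.
move=> sf; have sNf := rsummableN sf.
have [c0|/ltW c0] := leP 0 c.
  rewrite (@rsum_decomp _ (fun i => c * pos f i)
    (fun i => c * pos (fun i => - f i) i)).
  - by rewrite !nsumZ ?pos_sum// mulrBr.
  - by move=> i; rewrite mulr_ge0.
  - by move=> i; rewrite mulr_ge0.
  - by apply: rsummableZ; exact: pos_sum.
  - by apply: rsummableZ; exact: pos_sum.
  - by move=> i; rewrite {1}(posB f) mulrBr.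
have d0 : 0 <= - c by rewrite oppr_ge0.
rewrite (@rsum_decomp _ (fun i => - c * pos (fun i => - f i) i)
  (fun i => - c * pos f i)).
- by rewrite !nsumZ ?pos_sum// -mulrBr mulNr -mulrN opprB.
- by move=> i; rewrite mulr_ge0.
- by move=> i; rewrite mulr_ge0.
- by apply: rsummableZ; exact: pos_sum.
- by apply: rsummableZ; exact: pos_sum.
- by move=> i; rewrite {1}(posB f) -mulrBr mulNr -mulrN opprB.
Qed.

Lemma rsumN f : rsummable f -> rsum (fun i => - f i) = - rsum f.
Proof.
move=> sf; rewrite -mulN1r -rsumZ//.
by congr rsum; apply/funext => i; rewrite mulN1r.
Qed.

Lemma rsum_ge0 f : (forall i, 0 <= f i) -> rsummable f -> rsum f = nsum f.
Proof.
move=> f0 sf; have s0 : rsummable (fun=> 0 : R).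
  by apply: rsummable_le sf => i; rewrite normr0.
rewrite (@rsum_decomp f f (fun=> 0))//; last by move=> i; rewrite subr0.
by rewrite {2}/nsum esum1// subr0.
Qed.

Lemma nsum_ge f i : (forall i, 0 <= f i) -> rsummable f -> f i <= nsum f.
Proof.
move=> f0 sf; rewrite -lee_fin -nsum_fin//.
by apply: esum_ge; exists [set i]; [split|rewrite fsbig_set1].
Qed.

Definition csummable (f : I -> R[i]) :=
  rsummable (fun i => complex.Re (f i)) /\
  rsummable (fun i => complex.Im (f i)).

Lemma csum_linear (a : R[i]) (f g : I -> R[i]) : csummable f -> csummable g ->
  csum (fun i => a * f i + g i) = a * csum f + csum g.
Proof.
case: a => a b [f1 f2] [g1 g2]; rewrite /csum; apply/eqP; rewrite eq_complex /=.
have -> : (fun i => complex.Re ((a +i* b) * f i + g i)) =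
  (fun i => (a * complex.Re (f i) + - (b * complex.Im (f i))) + complex.Re (g i)).
  by apply/funext => i; case: (f i) => ? ?; case: (g i).
have -> : (fun i => complex.Im ((a +i* b) * f i + g i)) =
  (fun i => (a * complex.Im (f i) + b * complex.Re (f i)) + complex.Im (g i)).
  by apply/funext => i; case: (f i) => ? ?; case: (g i).
have Z c h : rsummable h -> rsummable (fun i => c * h i) := @rsummableZ c h.
have N h : rsummable h -> rsummable (fun i => - h i) := @rsummableN h.
have sa := Z a _ f1; have sb := N _ (Z b _ f2).
have ta := Z a _ f2; have tb := Z b _ f1.
rewrite (rsumD (rsummableD sa sb) g1) (rsumD (rsummableD ta tb) g2).
rewrite (rsumD sa sb) (rsumD ta tb) (rsumN (Z b _ f2)).
by rewrite (rsumZ _ f1) (rsumZ _ f2) (rsumZ _ f1) (rsumZ _ f2) !eqxx.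
Qed.

End SumTheory.

Lemma ReN (R : realType) (z : R[i]) : complex.Re (- z) = - complex.Re z.
Proof. by case: z. Qed.

Section InnerProduct.
Context {R : realType} {V : lmodType R[i]} (d : {dot V for Num.conj}).
Implicit Types (x y : V) (N M : set V).

Definition hsqn x : R := complex.Re (d x x).

Definition hnorm x : R := Num.sqrt (hsqn x).

Lemma dot_sqn x : d x x = (hsqn x)%:C.
Proof. by rewrite /hsqn RRe_real// ger0_real// dnorm_ge0. Qed.

Lemma hsqn_ge0 x : 0 <= hsqn x.
Proof. by rewrite -ler0c -dot_sqn dnorm_ge0. Qed.

Lemma hsqn0 : hsqn 0 = 0.
Proof. by rewrite /hsqn linear0l. Qed.

Lemma hsqn_eq0 x : hsqn x = 0 -> x = 0.
Proof. by move=> h; apply/eqP; rewrite -(dnorm_eq0 d) dot_sqn h. Qed.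

Lemma hsqnD x y : hsqn (x + y) = hsqn x + hsqn y + 2 * complex.Re (d x y).
Proof.
rewrite /hsqn dnormD/= addcJ.
by case: (d x x) (d y y) (d x y) => [? ?] [? ?] [? ?] /=; lra.
Qed.

Lemma hsqnN x : hsqn (- x) = hsqn x.
Proof. by rewrite /hsqn hnormN. Qed.

Lemma hsqnD_le x y : hsqn (x + y) <= 2 * hsqn x + 2 * hsqn y.
Proof.
have := hsqn_ge0 (x - y); rewrite !hsqnD hsqnN linearNr ReN.
by lra.
Qed.

Lemma hsqnZ (a : R[i]) x :
  hsqn (a *: x) = (complex.Re a ^+ 2 + complex.Im a ^+ 2) * hsqn x.
Proof.
apply: complexI; rewrite -dot_sqn dnormZ -add_Re2_Im2 dot_sqn.
by rewrite rmorphM.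
Qed.

Lemma Re_dot_le x y : `|complex.Re (d x y)| <= hsqn x + hsqn y.
Proof.
have h1 := hsqn_ge0 (x + y); have h2 := hsqn_ge0 (x - y).
have h3 := hsqn_ge0 x; have h4 := hsqn_ge0 y.
move: h1 h2; rewrite !hsqnD hsqnN linearNr ReN ler_norml.
by lra.
Qed.

Lemma Im_dot_le x y : `|complex.Im (d x y)| <= hsqn x + hsqn y.
Proof.
have := Re_dot_le ('i%C *: x) y; rewrite hsqnZ linearZl_LR /=.
by case: (d x y) => a b /=; rewrite expr0n expr1n add0r mul1r mul0r mul1r sub0r normrN.
Qed.

End InnerProduct.

Section Ell2.
Context {R : realType} {E : lmodType R[i]} (I : choiceType)
  (dE : {dot E for Num.conj}).

Definition ell2_pred : {pred I -> E} :=
  fun f => `[< rsummable (fun i => hsqn dE (f i)) >].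

Fact ell2_submod_closed : submod_closed ell2_pred.
Proof.
split.
  apply/asboolP; rewrite /rsummable /summable esum1// => i _.
  by rewrite hsqn0 /= normr0.
move=> a f g /asboolP sf /asboolP sg; apply/asboolP.
pose c := 2 * (complex.Re a ^+ 2 + complex.Im a ^+ 2).
apply: (rsummable_le (g := fun i => c * hsqn dE (f i) + 2 * hsqn dE (g i))).
  move=> i; rewrite ger0_norm ?hsqn_ge0// (le_trans (hsqnD_le _ _ _))//.
  by rewrite hsqnZ mulrA.
by apply: rsummableD; exact: rsummableZ.
Qed.

HB.instance Definition _ :=
  GRing.isSubmodClosed.Build R[i] (I -> E) ell2_pred ell2_submod_closed.

Record ell2 := Ell2 { ell2_val :> I -> E ; ell2_valP : ell2_val \in ell2_pred }.

HB.instance Definition _ := [isSub for ell2_val].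
HB.instance Definition _ := [Choice of ell2 by <:].
HB.instance Definition _ := [SubChoice_isSubZmodule of ell2 by <:].
HB.instance Definition _ := [SubZmodule_isSubLmodule of ell2 by <:].

Definition ell2_dot (f g : ell2) : R[i] := csum (fun i => dE (f i) (g i)).

Let dot_csummable (f g : ell2) : csummable (fun i => dE (f i) (g i)).
Proof.
have sf := asboolW (ell2_valP f); have sg := asboolW (ell2_valP g).
split; apply: rsummable_le (rsummableD sf sg) => i.
- exact: Re_dot_le.
- exact: Im_dot_le.
Qed.

Let dotC (f g : ell2) : ell2_dot f g = Num.conj (ell2_dot g f).
Proof.
have [_ sI] := dot_csummable g f.
have -> : ell2_dot f g = csum (fun i => Num.conj (dE (g i) (f i))).
  by congr csum; apply/funext => i; rewrite hermC expr0 mul1r.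
have conjE z : Num.conj z = (complex.Re z -i* complex.Im z) :> R[i] by case: z.
rewrite conjE /ell2_dot /csum /= -rsumN//.
by congr Complex; congr rsum; apply/funext => i; rewrite conjE.
Qed.

Let dot_linearl (g : ell2) : linear_for *%R (ell2_dot ^~ g).
Proof.
move=> a f h; rewrite /ell2_dot -csum_linear; try exact: dot_csummable.
congr csum; apply/funext => i.
by rewrite -linearPl.
Qed.

Let dot_linearr (f : ell2) : linear_for (Num.conj \; *%R) (ell2_dot f).
Proof.
move=> a g h; rewrite dotC dot_linearl rmorphD rmorphM /= -!dotC.
by [].
Qed.

HB.instance Definition _ := bilinear_isBilinear.Build R[i] ell2 ell2 R[i]
  *%R (Num.conj \; *%R) ell2_dot (dot_linearl, dot_linearr).

Fact ell2_dot_herm (f g : ell2) :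
  ell2_dot f g = (-1) ^+ false * Num.conj (ell2_dot g f).
Proof. by rewrite expr0 mul1r dotC. Qed.

HB.instance Definition _ :=
  isHermitianSesquilinear.Build R[i] ell2 false Num.conj ell2_dot ell2_dot_herm.

Fact ell2_dot_gt0 (f : ell2) : f != 0 -> 0 < ell2_dot f f.
Proof.
move=> f0; have sf := asboolW (ell2_valP f).
have f_ge0 i : 0 <= hsqn dE (f i) := hsqn_ge0 dE (f i).
have -> : ell2_dot f f = (nsum (fun i => hsqn dE (f i)))%:C.
  rewrite -[in RHS]rsum_ge0//; congr Complex.
  have -> : (fun i => complex.Im (dE (f i) (f i))) = fun=> 0.
    by apply/funext => i; rewrite dot_sqn.
  rewrite rsum_ge0//; first by rewrite /nsum esum1.
  by apply: rsummable_le sf => i; rewrite normr0.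
have [i fi0] : exists i, f i != 0.
  apply/not_existsP => h; move/eqP: f0; apply; apply/val_inj/funext => i.
  by have /negP/negbNE/eqP := h i.
rewrite -[0]/(real_complex R 0) ltcR (lt_le_trans _ (nsum_ge i f_ge0 sf))//.
by rewrite lt_def f_ge0 andbT; apply: contra fi0 => /eqP/hsqn_eq0 ->.
Qed.

HB.instance Definition _ := isDotProduct.Build R[i] ell2 ell2_dot ell2_dot_gt0.

End Ell2.

Arguments ell2_dot {R E} I dE f g.
Arguments Ell2 {R E I dE} [ell2_val] ell2_valP.

Section Span.
Context {K : fieldType} {V : lmodType K}.
Implicit Types A N : set V.

Definition lspan A : set V :=
  [set v | exists (m : nat) (c : 'I_m -> K) (b : 'I_m -> V),
     (forall i, A (b i)) /\ v = \sum_(i < m) c i *: b i].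

Definition lin_indep (m : nat) (b : 'I_m -> V) : Prop :=
  forall c : 'I_m -> K, \sum_(i < m) c i *: b i = 0 -> forall i, c i = 0.

Definition has_dim N (m : nat) : Prop :=
  exists b : 'I_m -> V, lin_indep b /\ lspan (range b) = N.

(* The dimension of a finite-dimensional subspace, and a junk value when there
   is no finite basis. *)
Definition fdim N : nat := xget 0%N [set m | has_dim N m].

End Span.

Definition finite_rank (K : fieldType) (T : Type) (V : lmodType K)
  (A : T -> V) : Prop := exists m : nat, has_dim (range A) m.

Definition op_rank (K : fieldType) (T : Type) (V : lmodType K) (A : T -> V) : nat :=
  fdim (range A).

Section Hilbert.
Context {R : realType} {V : lmodType R[i]} (d : {dot V for Num.conj}).
Implicit Types (x y : V) (M N : set V) (A Y : V -> V).

(* Completeness for the norm induced by d, i.e. (V, d) is a Hilbert space. *)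
Definition is_hilbert : Prop :=
  forall u : nat -> V,
    (forall e : R, 0 < e -> exists n0 : nat, forall p q : nat,
       (n0 <= p)%N -> (n0 <= q)%N -> hnorm d (u p - u q) < e) ->
    exists x, (fun p : nat => hnorm d (u p - x)) @ \oo --> (0 : R).

Definition hclosed M : Prop :=
  forall (u : nat -> V) x, (forall p, M (u p)) ->
    (fun p : nat => hnorm d (u p - x)) @ \oo --> (0 : R) -> M x.

Definition closed_subspace M : Prop := submod_closed (mem M) /\ hclosed M.

Definition bounded_linear A : Prop :=
  linear A /\ exists c : R, forall x, hnorm d (A x) <= c * hnorm d x.

Definition adjoint A : V -> V :=
  fun y => xget 0 [set z | forall x, d (A x) y = d x z].

Definition oproj N : V -> V :=
  fun x => xget 0 [set y | N y /\ forall z, N z -> d (x - y) z = 0].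

Definition orthc M : {pred V} := fun x => `[< forall y, M y -> d x y = 0 >].

Fact orthc_submod_closed M : submod_closed (orthc M).
Proof.
split; first by apply/asboolP => y _; rewrite linear0l.
move=> a x y /asboolP dx /asboolP dy; apply/asboolP => z Mz.
by rewrite linearPl /= dx// dy// mulr0 addr0.
Qed.

HB.instance Definition _ M :=
  GRing.isSubmodClosed.Build R[i] V (orthc M) (orthc_submod_closed M).

(* The orthogonal complement of M as a space of its own. *)
Record orth M := Orth { orth_val :> V ; orth_valP : orth_val \in orthc M }.

HB.instance Definition _ M := [isSub for @orth_val M].
HB.instance Definition _ M := [Choice of orth M by <:].
HB.instance Definition _ M := [SubChoice_isSubZmodule of orth M by <:].
HB.instance Definition _ M := [SubZmodule_isSubLmodule of orth M by <:].

Definition orth_dot M (x y : orth M) : R[i] := d (val x) (val y).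

Fact orth_dot_bilinear M :
  bilinear_for *%R (Num.conj \; *%R) (@orth_dot M).
Proof.
by split=> [y a x z|x a y z]; rewrite /orth_dot ?linearPl ?linearPr.
Qed.

HB.instance Definition _ M := bilinear_isBilinear.Build R[i] (orth M) (orth M)
  R[i] *%R (Num.conj \; *%R) (@orth_dot M) (orth_dot_bilinear M).

Fact orth_dot_herm M (x y : orth M) :
  orth_dot x y = (-1) ^+ false * Num.conj (orth_dot y x).
Proof. exact: hermitian_subproof. Qed.

HB.instance Definition _ M := isHermitianSesquilinear.Build R[i] (orth M)
  false Num.conj (@orth_dot M) (@orth_dot_herm M).

Fact orth_dot_gt0 M (x : orth M) : x != 0 -> 0 < orth_dot x x.
Proof. by move=> x0; apply: neq0_dnorm_gt0. Qed.

HB.instance Definition _ M :=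
  isDotProduct.Build R[i] (orth M) (@orth_dot M) (@orth_dot_gt0 M).

(* P_{M^perp} A |_{M^perp} *)
Definition compress M A : orth M -> orth M :=
  fun x : orth M => insubd (0 : orth M) (oproj [set` orthc M] (A (val x))).

End Hilbert.

Arguments orth_dot {R V} d M x y.
Arguments compress {R V} d M A _.

Section Euler.
Context {R : realType} (k : nat) (n : 'I_k -> nat).
Implicit Types (q : k.-tuple nat) (Q : nat -> k.-tuple nat).

(* Tuples of words, one in each of the free semigroups on 'I_(n i). *)
Definition word : Type := {dffun forall i : 'I_k, seq 'I_(n i)}.

HB.instance Definition _ := Choice.on word.

Definition word_le (w : word) q : Prop := forall i, (size (w i) <= tnth q i)%N.

Definition cons_word (i : 'I_k) (j : 'I_(n i)) (w : word) : word :=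
  finfun (eqtype.dfwith (T := fun l => seq 'I_(n l)) w (j :: w i)).

Definition increasing_cofinal Q : Prop :=
  (forall m i, (tnth (Q m) i <= tnth (Q m.+1) i)%N) /\
  (forall q, exists m, forall i, (tnth q i <= tnth (Q m) i)%N).

Section Tuple.
Context {V : lmodType R[i]} (d : {dot V for Num.conj}).
Variable T : forall i : 'I_k, 'I_(n i) -> V -> V.

Definition Phi (i : 'I_k) (Y : V -> V) : V -> V :=
  fun x => \sum_(j < n i) T j (Y (adjoint d (T j) x)).

(* (id - Phi_1) o ... o (id - Phi_k) (I) *)
Definition defect : V -> V :=
  foldr (fun (i : 'I_k) (Y : V -> V) x => Y x - Phi i Y x) id (enum 'I_k).

(* T_{1,w_1} ... T_{k,w_k} h *)
Definition word_op (w : word) (h : V) : V :=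
  foldr (fun (i : 'I_k) x => foldr (fun j => T (i := i) j) x (w i)) h
    (enum 'I_k).

Definition Mspace q : set V :=
  lspan [set v | exists (w : word) (h : V),
    [/\ word_le w q, range defect h & v = word_op w h]].

(* chi(T) is defined and equal to chi. *)
Definition is_euler_char (chi : R) : Prop :=
  [/\ is_hilbert d,
      forall i (j : 'I_(n i)), bounded_linear d (T j),
      forall s t (i : 'I_(n s)) (j : 'I_(n t)), s != t ->
        T i \o T j = T j \o T i,
      finite_rank defect &
      forall Q, increasing_cofinal Q ->
        (fun m => (fdim (Mspace (Q m)))%:R /
           \prod_(i < k) \sum_(p < (tnth (Q m) i).+1) (n i)%:R ^+ p) @ \oo
          --> chi].

End Tuple.

End Euler.

(* is_iter_lim a l : lim_{q_1} ... lim_{q_k} a(q_1,...,q_k) = l, where each of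
   the successive limits exists. *)
Fixpoint is_iter_lim (R : realType) (k : nat) :
    (k.-tuple nat -> R) -> R -> Prop :=
  match k with
  | 0 => fun a l => a [tuple] = l
  | k'.+1 => fun a l => exists b : nat -> R,
      (forall q, is_iter_lim (fun t : k'.-tuple nat => a [tuple of q :: t]) (b q))
      /\ b @ \oo --> l
  end.

Section Scalars.
Context {R : realType}.

Definition cdot (x y : R[i]^o) : R[i] := x * Num.conj y.

Fact cdot_bilinear : bilinear_for *%R (Num.conj \; *%R) cdot.
Proof.
split=> [y a x z|x a y z]; rewrite /cdot /=.
  by rewrite mulrDl -mulrA.
by rewrite rmorphD mulrDr rmorphM mulrCA.
Qed.

HB.instance Definition _ := bilinear_isBilinear.Build R[i] R[i]^o R[i]^o R[i]
  *%R (Num.conj \; *%R) cdot cdot_bilinear.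

Fact cdot_herm (x y : R[i]^o) : cdot x y = (-1) ^+ false * Num.conj (cdot y x).
Proof.
have h (a b : R[i]) : a * Num.conj b = Num.conj (b * Num.conj a).
  by rewrite rmorphM /= conjCK mulrC.
by rewrite expr0 mul1r; exact: h.
Qed.

HB.instance Definition _ := isHermitianSesquilinear.Build R[i] R[i]^o
  false Num.conj cdot cdot_herm.

Fact cdot_gt0 (x : R[i]^o) : x != 0 -> 0 < cdot x x.
Proof. by move=> x0; rewrite /cdot mul_conjC_gt0. Qed.

HB.instance Definition _ := isDotProduct.Build R[i] R[i]^o cdot cdot_gt0.

End Scalars.

Arguments cdot R x y : clear implicits.

(* F^2(H_{n_1}) (x) ... (x) F^2(H_{n_k}) (x) E, in coordinates: the vector
   sum_w e_w (x) x_w is the square-summable family (x_w)_w in E, where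
   e_w = e^1_{w_1} (x) ... (x) e^k_{w_k}. *)
Notation fock n dE := (ell2 (word n) dE).
Notation fock_dot n dE := (ell2_dot (word n) dE).

Section Fock.
Context {R : realType} {E : lmodType R[i]} (k : nat) (n : 'I_k -> nat)
  (dE : {dot E for Num.conj}).
Implicit Types (w : word n) (q : k.-tuple nat).

Fact etensor_subproof w (x : E) :
  (fun v : word n => if v == w then x else 0) \in ell2_pred dE.
Proof.
apply/asboolP; rewrite /rsummable /summable.
rewrite (eq_esum (b := fun v =>
    if v \in [set w] then (hsqn dE x)%:E else 0)%E); last first.
  move=> v _; case: eqVneq => [->|/eqP vw].
    by rewrite mem_set//= ger0_norm ?hsqn_ge0.
  by rewrite memNset//= hsqn0 normr0.
by rewrite -esum_mkcond esum_set1 ?ltry// lee_fin hsqn_ge0.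
Qed.

(* e_w (x) x *)
Definition etensor w (x : E) : fock n dE := Ell2 (etensor_subproof w x).

Definition creation_fun (i : 'I_k) (j : 'I_(n i)) (f : word n -> E) : word n -> E :=
  fun w => match w i with
    | j' :: s => if j' == j
        then f (finfun (eqtype.dfwith (T := fun l => seq 'I_(n l)) w s)) else 0
    | [::] => 0
    end.

Lemma creation_fun_cons (i : 'I_k) (j : 'I_(n i)) (f : word n -> E) w :
  creation_fun j f (cons_word j w) = f w.
Proof.
rewrite /creation_fun /cons_word ffunE dfwith_in eqxx; congr f.
apply/ffunP => l; rewrite ffunE.
by case: eqtype.dfwithP => // l' il; rewrite ffunE dfwith_out.
Qed.

Lemma creation_fun_notin (i : 'I_k) (j : 'I_(n i)) (f : word n -> E) w :
  ~ range (cons_word j) w -> creation_fun j f w = 0.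
Proof.
rewrite /creation_fun; case wi: (w i) => [//|j' s]; case: eqP => // jj; subst j'.
case; exists (finfun (eqtype.dfwith (T := fun l => seq 'I_(n l)) w s)) => //.
apply/ffunP => l; rewrite ffunE ffunE dfwith_in -wi.
by case: eqtype.dfwithP => // l' il; rewrite ffunE dfwith_out.
Qed.

Fact cons_word_inj (i : 'I_k) (j : 'I_(n i)) : injective (cons_word j).
Proof.
move=> v w /ffunP vw; apply/ffunP => l; have := vw l; rewrite !ffunE.
case: (eqVneq i l) => [<-|il]; first by rewrite !dfwith_in => -[].
by rewrite !dfwith_out.
Qed.

Fact creation_subproof (i : 'I_k) (j : 'I_(n i)) (f : fock n dE) :
  creation_fun j f \in ell2_pred dE.
Proof.
have sf := asboolW (ell2_valP f); apply/asboolP; rewrite /rsummable /summable.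
rewrite (eq_esum (b := fun v => if v \in range (cons_word j)
    then `|(hsqn dE (creation_fun j f v))%:E| else 0)%E); last first.
  move=> v _; case: ifPn => // /negP; rewrite inE => /creation_fun_notin ->.
  by rewrite hsqn0 abse0.
rewrite -esum_mkcond esum_image; last by move=> ? ? _ _; exact: cons_word_inj.
by apply: le_lt_trans sf; apply: le_esum => v _; rewrite creation_fun_cons.
Qed.

(* S_{i,j} (x) I_E, where S_{i,j} e_w = e_{cons_word j w}. *)
Definition creation (i : 'I_k) (j : 'I_(n i)) (f : fock n dE) : fock n dE :=
  Ell2 (creation_subproof j f).

Lemma creation_etensor (i : 'I_k) (j : 'I_(n i)) w (x : E) :
  creation j (etensor w x) = etensor (cons_word j w) x.
Proof.
apply/val_inj/funext => v /=.
have [[u _ <-]|vN] := pselect (range (cons_word j) v).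
  by rewrite creation_fun_cons (inj_eq (@cons_word_inj i j)).
rewrite creation_fun_notin//; case: eqP => // vw; case: vN.
by exists w.
Qed.

Definition creation_invariant (M : set (fock n dE)) : Prop :=
  forall i (j : 'I_(n i)) f, M f -> M (creation j f).

(* P_{<= q} (x) I_E *)
Definition Ple q : fock n dE -> fock n dE :=
  oproj (fock_dot n dE)
    (lspan [set f | exists w x, word_le w q /\ f = etensor w x]).

End Fock.

Arguments creation {R E k n} dE i j f.
Arguments Ple {R E k n} dE q _.

(* Main.v *)
Require Import Defs.
From mathcomp Require Import all_boot all_order all_algebra.
From mathcomp Require Import sesquilinear.
From mathcomp.real_closed Require Import complex.
From mathcomp Require Import all_classical all_reals all_analysis.
From mathcomp Require Import ring lra.

(** Write H for the Fock space with coefficients in E, S_(i,j) for the creation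
    operators, P for the projection onto M^perp and V_q for the span of the
    e_w (x) x with w of multi-length at most q.

    Both quantities in the theorem are limits of the same ratio.  Since M is
    invariant, P S_(i,j) P = P S_(i,j) ([proj_creation]), so every expression
    in the compressions M_(i,j) and their adjoints is the compression of the
    same expression in the S_(i,j).  The defect of the creation operators is
    the projection onto the vacuum vectors e_() (x) x, hence the defect of the
    M_(i,j) has range P (e_() (x) E) ([range_defect]), the word w maps
    P (e_() (x) x) to P (e_w (x) x), and the space M_q of the tuple is exactly
    P V_q ([image_Mspace]), the range of P P_(<= q).

    Let N(q) be the number of words of multi-length at most q, and m(q) the
    dimension of V_q /\ ker P.  By rank-nullity dim P V_q = N(q) dim E - m(q)
    ([proj_image_dim]), so the ratio is dim E - u(q) / w(q) where u and w are m
    and N divided by D(q) = prod_i n_i^(q_i).  Now both m and N grow at least by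
    the factor n_i when q_i is increased by one: for m this holds because ker P
    is invariant and S_(i,1), ..., S_(i,n_i) are isometries with orthogonal
    ranges ([fock_ker_growth]).  So u and w are nondecreasing in each variable;
    they are bounded because n_i >= 2 gives N <= 2^k D ([nwords_le_top]), and
    w >= 1.  A bounded monotone function on N^k tends to its supremum along
    every cofinal sequence ([cofinal_sup]) and also has iterated limits, with
    the same value ([mono_iter_lim]).  Hence both limits exist and are equal to
    dim E - sup u / sup w.

    What this rests on analytically is that H is complete ([ell2_complete]) and
    that one can project onto an orthogonal complement in a complete space
    ([orthc_projection]). *)

Set Implicit Arguments.
Unset Strict Implicit.
Unset Printing Implicit Defensive.

Import Order.TTheory GRing.Theory Num.Theory.
Import numFieldNormedType.Exports.

Local Open Scope classical_set_scope.
Local Open Scope ring_scope.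
Local Open Scope complex_scope.

(** * Subspaces, finite families and dimension *)

Section Dimension.
Context {K : fieldType}.
Implicit Types V W : lmodType K.

Definition lin_subspace V (N : set V) : Prop :=
  N 0 /\ forall a x y, N x -> N y -> N (a *: x + y).

Definition comb V (T : finType) (b : T -> V) (c : T -> K) : V :=
  \sum_t c t *: b t.

Definition indep V (T : finType) (b : T -> V) : Prop :=
  forall c, comb b c = 0 -> forall t, c t = 0.

Lemma subspaceD V (N : set V) x y : lin_subspace N -> N x -> N y -> N (x + y).
Proof. by move=> [_ h] Nx Ny; rewrite -[x]scale1r; exact: h. Qed.

Lemma subspaceZ V (N : set V) a x : lin_subspace N -> N x -> N (a *: x).
Proof. by move=> [N0 h] Nx; rewrite -[_ *: _]addr0; exact: h. Qed.

Lemma subspaceB V (N : set V) x y : lin_subspace N -> N x -> N y -> N (x - y).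
Proof. by move=> sN Nx Ny; rewrite -scaleN1r addrC; apply: sN.2. Qed.

Lemma subspace_sum V (N : set V) (T : finType) (f : T -> V) :
  lin_subspace N -> (forall t, N (f t)) -> N (\sum_t f t).
Proof.
by move=> sN Nf; elim/big_ind: _ => // [|x y]; [exact: sN.1|exact: subspaceD].
Qed.

Lemma subspace_comb V (N : set V) (T : finType) (b : T -> V) c :
  lin_subspace N -> (forall t, N (b t)) -> N (comb b c).
Proof. by move=> sN Nb; apply: subspace_sum => // t; exact: subspaceZ. Qed.

Lemma subspaceI V (N N' : set V) :
  lin_subspace N -> lin_subspace N' -> lin_subspace (N `&` N').
Proof.
by move=> [? h] [? h']; split=> // a x y [? ?] [? ?]; split; [exact: h|exact: h'].
Qed.

Lemma subspace_range V (T : finType) (b : T -> V) : lin_subspace (range (comb b)).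
Proof.
split; first by exists (fun=> 0); rewrite // /comb big1// => t _; rewrite scale0r.
move=> a _ _ [c _ <-] [c' _ <-]; exists (fun t => a * c t + c' t) => //.
rewrite /comb scaler_sumr -big_split; apply: eq_bigr => t _ /=.
by rewrite scalerDl scalerA.
Qed.

Lemma linear_fun0 V W (f : V -> W) : linear f -> f 0 = 0.
Proof. by move=> fl; have := fl (-1) 0 0; rewrite scaler0 add0r scaleN1r addNr. Qed.

Lemma linear_funD V W (f : V -> W) : linear f -> {morph f : x y / x + y}.
Proof. by move=> fl x y; rewrite -[x in LHS]scale1r fl scale1r. Qed.

Lemma subspace_image V W (f : V -> W) (N : set V) :
  linear f -> lin_subspace N -> lin_subspace (f @` N).
Proof.
move=> fl [N0 h]; split.
  by exists 0 => //; exact: linear_fun0.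
by move=> a _ _ [x Nx <-] [y Ny <-]; exists (a *: x + y) ; [exact: h|exact: fl].
Qed.

Lemma linear_comb V W (f : V -> W) (T : finType) (b : T -> V) c :
  linear f -> f (comb b c) = comb (f \o b) c.
Proof.
move=> fl; have f0 := linear_fun0 fl.
rewrite /comb (big_morph f (linear_funD fl) f0); apply: eq_bigr => t _.
by rewrite -[_ *: _ in LHS]addr0 fl f0 addr0.
Qed.

Lemma comb_delta V (T : finType) (b : T -> V) t :
  comb b (fun u => (u == t)%:R) = b t.
Proof.
rewrite /comb (bigD1 t)//= eqxx scale1r big1 ?addr0// => u /negbTE ->.
by rewrite scale0r.
Qed.

Lemma mem_comb V (T : finType) (b : T -> V) t : range (comb b) (b t).
Proof. by exists (fun u => (u == t)%:R) => //; exact: comb_delta. Qed.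

Lemma comb_sum V (T1 T2 : finType) (b1 : T1 -> V) (b2 : T2 -> V) c :
  comb (fun t => match t with inl t => b1 t | inr t => b2 t end) c =
  comb b1 (c \o inl) + comb b2 (c \o inr).
Proof. by rewrite /comb big_sumType. Qed.

Lemma lspanP V (A : set V) (T : finType) (b : T -> V) c :
  (forall t, A (b t)) -> lspan A (comb b c).
Proof.
move=> Ab; exists #|T|, (c \o enum_val), (b \o enum_val); split.
  by move=> i; exact: Ab.
rewrite /comb (reindex (@enum_val T predT)) //=.
by apply: onW_bij; exact: enum_val_bij.
Qed.

Lemma subspace_lspan V (A : set V) : lin_subspace (lspan A).
Proof.
split; first by exists 0%N, (fun=> 0), (fun=> 0); split; [case|rewrite big_ord0].
move=> a _ _ [m [c [b [Ab ->]]]] [m' [c' [b' [Ab' ->]]]].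
rewrite scaler_sumr; under eq_bigr do rewrite scalerA.
pose cc (t : 'I_m + 'I_m') := match t with inl t => a * c t | inr t => c' t end.
have := @lspanP _ A _ (fun t => match t with inl t => b t | inr t => b' t end) cc.
by rewrite comb_sum; apply; case.
Qed.

Lemma lspan_gen V (A : set V) x : A x -> lspan A x.
Proof.
move=> Ax; exists 1%N, (fun=> 1), (fun=> x); split=> //.
by rewrite big_ord1 scale1r.
Qed.

Lemma lspan_min V (A N : set V) : lin_subspace N -> A `<=` N -> lspan A `<=` N.
Proof.
move=> sN AN _ [m [c [b [Ab ->]]]].
by apply: subspace_comb => // t; apply: AN.
Qed.

Lemma lspan_range V (T : finType) (b : T -> V) :
  lspan (range b) = range (comb b).
Proof.
apply/seteqP; split; last by move=> _ [c _ <-]; apply: lspanP => t; exists t.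
apply: lspan_min; first exact: subspace_range.
by move=> _ [t _ <-]; exact: mem_comb.
Qed.

Lemma basis_has_dim V (N : set V) (T : finType) (b : T -> V) :
  indep b -> range (comb b) = N -> has_dim N #|T|.
Proof.
move=> bi bN; exists (b \o enum_val); split.
  move=> c c0 i; pose c' t := c (enum_rank t).
  rewrite -(enum_valK i); apply: (bi c'); rewrite -[RHS]c0.
  rewrite /comb (reindex (@enum_val T predT)) /=; last first.
    by apply: onW_bij; exact: enum_val_bij.
  by apply: eq_bigr => j _; rewrite /c' enum_valK.
rewrite -bN -lspan_range; congr lspan; apply/seteqP; split=> _ [t _ <-].
  by exists (enum_val t).
by exists (enum_rank t) => //=; rewrite enum_rankK.
Qed.

Lemma has_dim_basis V (N : set V) m : has_dim N m ->
  exists b : 'I_m -> V, indep b /\ range (comb b) = N.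
Proof. by move=> [b [bi bN]]; exists b; rewrite -lspan_range. Qed.

(** Steinitz: the coefficient matrix of an independent family in terms of a
    spanning family has no nonzero left kernel. *)
Lemma indep_card V (T T' : finType) (b : T -> V) (e : T' -> V) :
  indep b -> (forall t, range (comb e) (b t)) -> (#|T| <= #|T'|)%N.
Proof.
move=> bi be; have [a aE] : {a : T -> T' -> K & forall t, comb e (a t) = b t}.
  apply: (@choice _ _ (fun t c => comb e c = b t)) => t.
  by have [c _ <-] := be t; exists c.
pose A := \matrix_(i < #|T|, j < #|T'|) a (enum_val i) (enum_val j).
have Afree : row_free A.
  rewrite -kermx_eq0; apply/eqP/row_matrixP => i; rewrite row0.
  set u := row i _; have uA : u *m A = 0 by apply/sub_kermxP; exact: row_sub.
  apply/rowP => l; rewrite [RHS]mxE -(enum_valK l).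
  apply: (bi (fun t => u 0 (enum_rank t))) => /=.
  transitivity (\sum_t' (\sum_t u 0 (enum_rank t) * a t t') *: e t').
    rewrite /comb; under eq_bigr do rewrite -aE /comb scaler_sumr.
    rewrite exchange_big; apply: eq_bigr => t' _ /=; rewrite scaler_suml.
    by apply: eq_bigr => t _; rewrite scalerA.
  apply: big1 => t' _.
  rewrite [X in X *: _](_ : _ = (u *m A) 0 (enum_rank t')).
    by rewrite uA [in LHS]mxE scale0r.
  rewrite [RHS]mxE (reindex (@enum_val T predT)) /=; last first.
    by apply: onW_bij; exact: enum_val_bij.
  by apply: eq_bigr => j _; rewrite enum_valK [A _ _]mxE enum_rankK.
by rewrite -(eqP Afree) rank_leq_col.
Qed.

Lemma indep_le_dim V (N : set V) m (T : finType) (b : T -> V) :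
  has_dim N m -> indep b -> (forall t, N (b t)) -> (#|T| <= m)%N.
Proof.
move=> /has_dim_basis [e [_ <-]] bi be.
by rewrite -[X in (_ <= X)%N]card_ord; exact: (indep_card bi be).
Qed.

Lemma has_dim_uniq V (N : set V) m m' : has_dim N m -> has_dim N m' -> m = m'.
Proof.
have le p p' : has_dim N p -> has_dim N p' -> (p <= p')%N.
  move=> /has_dim_basis [b [bi bN]] Np'; rewrite -[X in (X <= _)%N]card_ord.
  by apply: indep_le_dim Np' bi _ => t; rewrite -bN; exact: mem_comb.
by move=> h h'; apply/eqP; rewrite eqn_leq !le.
Qed.

Lemma fdimE V (N : set V) m : has_dim N m -> fdim N = m.
Proof.
move=> Nm; rewrite /fdim; case: xgetP => [p _ Np|/(_ m)//].
exact: has_dim_uniq Np Nm.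
Qed.

(** A basis of the kernel of f in N and preimages of a basis of f(N)
    together form a basis of N. *)
Lemma rank_nullity V W (f : V -> W) (N : set V) m r :
  linear f -> lin_subspace N -> has_dim (N `&` [set x | f x = 0]) m ->
  has_dim (f @` N) r -> has_dim N (m + r).
Proof.
move=> fl sN /has_dim_basis [b [bi bN]] /has_dim_basis [e [ei eN]].
have bk t : N (b t) /\ f (b t) = 0.
  by suff : (N `&` [set x | f x = 0]) (b t) by []; rewrite -bN; exact: mem_comb.
have [g gE] : {g : 'I_r -> V & forall t, N (g t) /\ f (g t) = e t}.
  apply: (@choice _ _ (fun t x => N x /\ f x = e t)) => t.
  have : (f @` N) (e t) by rewrite -eN; exact: mem_comb.
  by case=> x Nx <-; exists x.
have fcb c : f (comb b c) = 0.
  by rewrite linear_comb// /comb big1// => t _ /=; rewrite (bk t).2 scaler0.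
have fcg c : f (comb g c) = comb e c.
  by rewrite linear_comb//; apply: eq_bigr => t _ /=; rewrite (gE t).2.
rewrite [X in has_dim _ X](_ : _ = #|{: 'I_m + 'I_r}|);
  last by rewrite card_sum !card_ord.
apply: (@basis_has_dim _ _ _ (fun t => match t with inl t => b t | inr t => g t end)).
  move=> c; rewrite comb_sum => h.
  have c2 t : c (inr t) = 0.
    apply: (ei (c \o inr)); rewrite -fcg -[LHS]add0r -(fcb (c \o inl)).
    by rewrite -linear_funD// h linear_fun0.
  move: h; rewrite [X in _ + X](_ : _ = 0); last first.
    by rewrite /comb big1// => t _ /=; rewrite c2 scale0r.
  by rewrite addr0 => /bi c1; case=> t; [exact: (c1 t)|exact: c2].
apply/seteqP; split.
  move=> _ [c _ <-]; apply: subspace_comb => //.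
  by case=> t; [exact: (bk t).1|exact: (gE t).1].
move=> x Nx.
have [c _ cE] : range (comb e) (f x) by rewrite eN; exists x.
have [c' _ c'E] : range (comb b) (x - comb g c).
  rewrite bN; split.
    by apply: subspaceB => //; apply: subspace_comb => // t; exact: (gE t).1.
  by rewrite /= -scaleN1r addrC fl scaleN1r fcg cE addNr.
exists (fun t => match t with inl t => c' t | inr t => c t end) => //.
by rewrite comb_sum [comb b _]c'E subrK.
Qed.

End Dimension.

Lemma image_lspan (K : fieldType) (V W : lmodType K) (f : V -> W) (A : set V) :
  linear f -> f @` lspan A = lspan (f @` A).
Proof.
move=> fl; apply/seteqP; split; last first.
  apply: lspan_min; first exact: subspace_image (subspace_lspan A).
  by move=> _ [x Ax <-]; exists x => //; exact: lspan_gen.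
move=> _ [_ [m [c [b [Ab ->]]]] <-].
rewrite [f _](linear_comb _ _ fl); apply: lspanP => t /=.
by exists (b t).
Qed.

Lemma linear_funB (K : fieldType) (V W : lmodType K) (f : V -> W) :
  linear f -> {morph f : x y / x - y}.
Proof. by move=> fl x y; rewrite addrC -scaleN1r fl scaleN1r addrC. Qed.

Lemma linear_fun_sum (K : fieldType) (V W : lmodType K) (f : V -> W)
    (T : finType) (F : T -> V) : linear f -> f (\sum_t F t) = \sum_t f (F t).
Proof.
by move=> fl; exact: (big_morph f (linear_funD fl) (linear_fun0 fl)).
Qed.

Lemma has_dim0 (K : fieldType) (V : lmodType K) : has_dim [set (0 : V)] 0.
Proof.
exists (fun=> 0); split; first by move=> c _ [].
apply/seteqP; split.
  by move=> _ [m [c [b [b0 ->]]]]; apply: big1 => i _; have [[]] := b0 i.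
by move=> _ ->; exists 0%N, (fun=> 0), (fun=> 0); split; [case|rewrite big_ord0].
Qed.

Lemma has_dim_preimage (K : fieldType) (V W : lmodType K) (f : V -> W)
    (N : set V) m : linear f -> (forall x, f x = 0 -> x = 0) ->
  lin_subspace N -> has_dim (f @` N) m -> has_dim N m.
Proof.
move=> fl fi sN; apply: (rank_nullity (m := 0) fl sN).
rewrite (_ : _ `&` _ = [set 0]); first exact: has_dim0.
apply/seteqP; split; first by move=> x [_ /fi].
by move=> _ ->; split; [exact: sN.1|exact: linear_fun0].
Qed.

(** * Completeness, orthonormal bases and orthogonal projections *)

(** Finite sums over an arbitrary sequence, as needed for the partial sums
    of a square-summable family. *)
Lemma cvg_sum0 (R : realType) (I : Type) (r : seq I) (f : I -> nat -> R) :
  (forall i, f i @ \oo --> (0 : R)) ->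
  (fun m => \sum_(i <- r) f i m) @ \oo --> (0 : R).
Proof.
move=> f0; elim: r => [|i r IH].
  rewrite (_ : (fun _ => _) = fun=> 0); first exact: cvg_cst.
  by apply/funext => m; rewrite big_nil.
rewrite (_ : (fun _ => _) = fun m => f i m + \sum_(j <- r) f j m); last first.
  by apply/funext => m; rewrite big_cons.
by rewrite -[X in _ --> X]addr0; apply: cvgD.
Qed.

Section InnerProduct.
Context {R : realType}.

Definition csq (z : R[i]) : R := complex.Re z ^+ 2 + complex.Im z ^+ 2.

Lemma csq_ge0 z : 0 <= csq z.
Proof. by rewrite addr_ge0 ?sqr_ge0. Qed.

Lemma csq_eq0 z : csq z = 0 -> z = 0.
Proof.
case: z => a b /= /eqP; rewrite paddr_eq0 ?sqr_ge0// !sqrf_eq0 /=.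
by move=> /andP[/eqP -> /eqP ->].
Qed.

Lemma real_complete (u : nat -> R) :
  (forall e : R, 0 < e -> exists n0, forall p q, (n0 <= p)%N -> (n0 <= q)%N ->
     (u p - u q) ^+ 2 < e) ->
  exists l, (fun p => (u p - l) ^+ 2) @ \oo --> (0 : R).
Proof.
move=> uc; suff /cauchy_cvgP ul : cauchy (u @ \oo).
  exists (lim (u @ \oo)).
  have {1}-> : (0 : R) = (lim (u @ \oo) - lim (u @ \oo)) ^+ 2.
    by rewrite subrr expr0n.
  have h : (fun p => u p - lim (u @ \oo)) @ \oo --> lim (u @ \oo) - lim (u @ \oo).
    by apply: cvgB => //; exact: cvg_cst.
  by rewrite expr2; apply: cvg_trans (cvgM h h).
apply/cauchyP => e e0; have e20 : 0 < e ^+ 2 by rewrite exprn_gt0.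
have [n0 un0] := uc _ e20; exists (u n0).
exists n0 => // p /= np; rewrite /ball /=.
have := un0 _ _ (leqnn n0) np.
by rewrite -(real_normK (num_real (u n0 - u p))) ltr_pXn2r ?nnegrE ?normr_ge0 ?(ltW e0).
Qed.

Lemma complex_complete (u : nat -> R[i]) :
  (forall e : R, 0 < e -> exists n0, forall p q, (n0 <= p)%N -> (n0 <= q)%N ->
     csq (u p - u q) < e) ->
  exists l, (fun p => csq (u p - l)) @ \oo --> (0 : R).
Proof.
move=> uc; have [|a ha] := @real_complete (fun p => complex.Re (u p)).
  move=> e /uc[n0 h]; exists n0 => p q np nq; apply: le_lt_trans (h p q np nq).
  by case: (u p) (u q) => ? ? [? ?]; rewrite lerDl sqr_ge0.
have [|b hb] := @real_complete (fun p => complex.Im (u p)).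
  move=> e /uc[n0 h]; exists n0 => p q np nq; apply: le_lt_trans (h p q np nq).
  by case: (u p) (u q) => ? ? [? ?]; rewrite lerDr sqr_ge0.
exists (a +i* b); rewrite -[X in _ --> X]addr0.
rewrite (_ : (fun p => _) = (fun p => (complex.Re (u p) - a) ^+ 2 +
    (complex.Im (u p) - b) ^+ 2)); first exact: cvgD.
by apply/funext => p; case: (u p).
Qed.

Section Dot.
Context {V : lmodType R[i]} (d : {dot V for Num.conj}).
Implicit Types (x y z : V) (N M : set V).

Definition hlim (u : nat -> V) x : Prop :=
  (fun p => hsqn d (u p - x)) @ \oo --> (0 : R).

Definition hcauchy (u : nat -> V) : Prop :=
  forall e : R, 0 < e -> exists n0, forall p q, (n0 <= p)%N -> (n0 <= q)%N ->
    hsqn d (u p - u q) < e.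

(** Completeness with squared norms: estimates then use only the
    parallelogram law and no square roots. *)
Definition hcomplete : Prop := forall u, hcauchy u -> exists x, hlim u x.

Lemma hcomplete_hilbert : hcomplete -> is_hilbert d.
Proof.
move=> hc u uc; have [|x ux] := hc u.
  move=> e e0; have [|n0 h] := uc (Num.sqrt e); first by rewrite sqrtr_gt0.
  exists n0 => p q np nq; have := h p q np nq.
  by rewrite /hnorm ltr_sqrt.
exists x; rewrite /hnorm -[X in _ --> X]sqrtr0.
apply: (@cvg_comp _ _ _ _ (@Num.sqrt R) _ _ _ ux).
exact: sqrt_continuous.
Qed.

Lemma dotC x y : d x y = Num.conj (d y x).
Proof. by rewrite hermC expr0 mul1r. Qed.

Lemma dot_eq0C x y : d x y = 0 -> d y x = 0.
Proof. by rewrite dotC => /eqP; rewrite fmorph_eq0 => /eqP. Qed.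

Lemma hsqnBC x y : hsqn d (x - y) = hsqn d (y - x).
Proof. by rewrite -hsqnN opprB. Qed.

Lemma dot_nondeg x : (forall y, d x y = 0) -> x = 0.
Proof. by move=> h; apply: (@hsqn_eq0 _ _ d); rewrite /hsqn h. Qed.

(** If y almost minimizes the distance from x to N, then x - y is almost
    orthogonal to N: compare y with y + a z for the a that minimizes
    |x - y - a z|.  The case delta = 0, N the whole space, y = 0 is the
    Cauchy-Schwarz inequality. *)
Lemma near_orthogonal N (delta : R) x y z : lin_subspace N ->
  (forall v, N v -> delta <= hsqn d (x - v)) -> N y -> N z ->
  csq (d (x - y) z) <= (hsqn d (x - y) - delta) * hsqn d z.
Proof.
move=> sN xd Ny Nz; have [z0|z0] := eqVneq (hsqn d z) 0.
  by rewrite (hsqn_eq0 z0) linear0r hsqn0 mulr0 /csq /= expr0n addr0.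
have zgt0 : 0 < hsqn d z by rewrite lt_def z0 hsqn_ge0.
set c := d (x - y) z; pose t := (hsqn d z)^-1.
have := xd _ (subspaceD sN Ny (subspaceZ (t%:C * c) sN Nz)).
rewrite opprD addrA; rewrite /c; move: (x - y) => w in c *; rewrite -/c.
rewrite hsqnD hsqnN hsqnZ linearNr linearZr_LR -/c ReN.
rewrite [_ ^+ 2 + _](_ : _ = t ^+ 2 * csq c); last first.
  by case: c => ? ?; rewrite /csq /=; ring.
rewrite [complex.Re (_ * c)](_ : _ = t * csq c); last first.
  by case: c => ? ?; rewrite /csq /=; ring.
have tz : t * hsqn d z = 1 by rewrite /t mulVf.
rewrite [_ * hsqn d z](_ : _ = t * csq c) => [h|]; last first.
  by rewrite -[RHS]mulr1 -tz; ring.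
have {}h : t * csq c <= hsqn d w - delta by move: h; lra.
rewrite -[csq c]mulr1 -tz mulrA [csq c * t]mulrC.
by apply: ler_wpM2r => //; exact: hsqn_ge0.
Qed.

Lemma cauchy_schwarz x y : csq (d x y) <= hsqn d x * hsqn d y.
Proof.
have := @near_orthogonal setT 0 x 0 y.
by rewrite !subr0; apply => //= *; exact: hsqn_ge0.
Qed.

Lemma hlim_dot0 (u : nat -> V) x y :
  hlim u x -> (fun p => csq (d (u p) y)) @ \oo --> (0 : R) -> d x y = 0.
Proof.
move=> ux uy; apply: csq_eq0; apply/eqP; rewrite eq_le csq_ge0 andbT.
pose f p : R := 2 * (hsqn d (u p - x) * hsqn d y) + 2 * csq (d (u p) y).
have fl : f @ \oo --> (2 * (0 * hsqn d y) + 2 * 0 : R).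
  by apply: cvgD; apply: cvgMr => //; apply: cvgMl.
have -> : (0 : R) = 2 * (0 * hsqn d y) + 2 * 0 by rewrite mul0r mulr0 addr0.
apply: (cvgr_to_ge fl); near=> p.
have := cauchy_schwarz (u p - x) y; rewrite linearBl /f.
have : csq (d x y) <= 2 * csq (d (u p) y - d x y) + 2 * csq (d (u p) y).
  case: (d x y) (d (u p) y) => a b [a' b']; rewrite /csq /=.
  have := sqr_ge0 (2 * a' - a); have := sqr_ge0 (2 * b' - b); lra.
by lra.
Unshelve. all: by end_near. Qed.

Lemma orthc_subspace M : lin_subspace [set` orthc d M].
Proof.
have [h0 h] := orthc_submod_closed d M.
by split => [|a x y]; [exact: h0|exact: h].
Qed.

Lemma orthcP M x : [set` orthc d M] x <-> forall y, M y -> d x y = 0.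
Proof. by split; [move/asboolP|move=> h; apply/asboolP]. Qed.

Lemma orthc_closed M (u : nat -> V) x :
  (forall p, [set` orthc d M] (u p)) -> hlim u x -> [set` orthc d M] x.
Proof.
move=> uM ux; apply/orthcP => y My; apply: (hlim_dot0 ux).
rewrite (_ : (fun _ => _) = fun=> 0); first exact: cvg_cst.
by apply/funext => p; rewrite (iffLR (orthcP _ _) (uM p))// /csq /= expr0n addr0.
Qed.

(** A minimizing sequence in the closed subspace N = M^perp is Cauchy by the
    parallelogram law, and its limit y satisfies x - y _|_ N because the terms
    of the sequence are almost orthogonal in the sense of [near_orthogonal]. *)
Theorem orthc_projection M x : hcomplete ->
  exists y, [set` orthc d M] y /\ forall z, [set` orthc d M] z -> d (x - y) z = 0.
Proof.
move=> hc; set N := [set` _]; have sN : lin_subspace N := orthc_subspace M.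
pose A := [set hsqn d (x - v) | v in N]; pose delta := inf A.
have A0 : A !=set0 by exists (hsqn d (x - 0)), 0 => //; exact: sN.1.
have lA : has_lbound A by exists 0 => _ [v _ <-]; exact: hsqn_ge0.
have dA v : N v -> delta <= hsqn d (x - v).
  by move=> Nv; apply: ge_inf => //; exists v.
have [u uE] : {u : nat -> V & forall p, N (u p) /\
    hsqn d (x - u p) < delta + p.+1%:R^-1}.
  apply: (@choice _ _ (fun p v => N v /\ hsqn d (x - v) < delta + p.+1%:R^-1)) => p.
  have [|_ [v Nv <-] h] := @inf_adherent _ A p.+1%:R^-1 _ (conj A0 lA).
    by rewrite invr_gt0.
  by exists v.
have hl : (fun p => p.+1%:R^-1 : R) @ \oo --> (0 : R) by exact: cvg_harmonic.
have uc : hcauchy u.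
  move=> e e0; have e4 : 0 < e / 4 by rewrite divr_gt0.
  have /cvgrPdist_lt/(_ _ e4)[n0 _ hn0] := hl.
  have small p : (n0 <= p)%N -> p.+1%:R^-1 < e / 4.
    by move=> /hn0; rewrite /= sub0r normrN ger0_norm// invr_ge0.
  exists n0 => p q /small np /small nq.
  have [Np hp] := uE p; have [Nq hq] := uE q.
  (* The parallelogram law, with the midpoint of u p and u q in N. *)
  have := dA _ (subspaceZ (2^-1) sN (subspaceD sN Np Nq)).
  set a := x - u p; set b := x - u q.
  have -> : x - 2^-1 *: (u p + u q) = 2^-1 *: (a + b).
    rewrite /a /b addrACA -opprD scalerBr; congr (_ - _).
    by rewrite -mulr2n -[x *+ 2]scaler_nat scalerA mulVf ?scale1r ?pnatr_eq0.
  have -> : u p - u q = - (a - b) by rewrite opprB /a /b opprB [RHS]addrC subrKA.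
  move: hp hq; rewrite -/a -/b hsqnN; move: a b => a b.
  rewrite hsqnZ !hsqnD hsqnN linearNr ReN.
  have -> : complex.Re (2^-1 : R[i]) ^+ 2 + complex.Im (2^-1 : R[i]) ^+ 2 = 4^-1 :> R.
    have -> : (2^-1 : R[i]) = (2^-1 : R)%:C by rewrite fmorphV rmorph_nat.
    by rewrite /= expr0n addr0 expr2 -invfM -natrM.
  move: (p.+1%:R^-1) (q.+1%:R^-1) np nq => s t np nq h1 h2 h3; lra.
have [y uy] := hc u uc; exists y; split.
  by apply: orthc_closed uy => p; exact: (uE p).1.
move=> z Nz; have uy' : hlim (fun p => x - u p) (x - y).
  rewrite /hlim (_ : (fun p => _) = fun p => hsqn d (u p - y))//.
  by apply/funext => p; rewrite opprB [x - _ + _]addrC subrKA hsqnBC.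
apply: (hlim_dot0 uy').
have hz : (fun p => p.+1%:R^-1 * hsqn d z) @ \oo --> (0 : R).
  by rewrite -(mul0r (hsqn d z)); apply: cvgMl.
apply: squeeze_cvgr hz; last exact: (cvg_cst (0:R)).
near=> p; rewrite csq_ge0 /=; have [Np hp] := uE p.
apply: le_trans (near_orthogonal sN dA Np Nz) _.
by apply: ler_wpM2r; [exact: hsqn_ge0|move: hp; move: p.+1%:R^-1 => s; lra].
Unshelve. all: by end_near. Qed.

End Dot.
End InnerProduct.

Section Projection.
Context {R : realType} {V : lmodType R[i]} (d : {dot V for Num.conj}).
Implicit Types (x y z : V) (N M : set V).

Definition is_proj N x y : Prop := N y /\ forall z, N z -> d (x - y) z = 0.

Definition projectable N : Prop := forall x, exists y, is_proj N x y.

Lemma is_proj_oproj N x : projectable N -> is_proj N x (oproj d N x).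
Proof.
move=> /(_ x) [y Ny]; rewrite /oproj; case: xgetP => [z _ //|/(_ y)]; exact.
Qed.

Lemma is_proj_uniq N x y y' : lin_subspace N ->
  is_proj N x y -> is_proj N x y' -> y = y'.
Proof.
move=> sN [Ny hy] [Ny' hy']; apply/eqP; rewrite -subr_eq0; apply/eqP.
apply: (@hsqn_eq0 _ _ d); rewrite /hsqn; set z := y - y'.
have Nz : N z by exact: subspaceB.
have zE : z = (x - y') - (x - y).
  by rewrite opprB [RHS]addrC subrKA.
by rewrite {1}zE linearBl /= hy// hy'// subrr.
Qed.

Lemma oproj_eq N x y : lin_subspace N -> is_proj N x y -> oproj d N x = y.
Proof.
move=> sN Ny; rewrite /oproj; case: xgetP => [z _ Nz|/(_ y)//].
exact: (is_proj_uniq sN Nz Ny).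
Qed.

Lemma oproj_id N x : lin_subspace N -> N x -> oproj d N x = x.
Proof.
by move=> sN Nx; apply: oproj_eq => //; split=> // z _; rewrite subrr linear0l.
Qed.

Lemma oproj_linear N : lin_subspace N -> projectable N -> linear (oproj d N).
Proof.
move=> sN pN a x y; apply: oproj_eq => //.
have [Nx hx] := is_proj_oproj x pN; have [Ny hy] := is_proj_oproj y pN.
split; first exact: sN.2.
move=> z Nz; rewrite opprD addrACA -scalerBr linearPl /=.
by rewrite hx// hy// mulr0 addr0.
Qed.

Lemma oproj_orth N x z : projectable N -> N z -> d (oproj d N x) z = d x z.
Proof.
move=> pN Nz; have [_ /(_ z Nz) h] := is_proj_oproj x pN.
by move: h; rewrite linearBl /= => /eqP; rewrite subr_eq0 => /eqP.
Qed.

Lemma oproj_le N x : projectable N -> hsqn d (oproj d N x) <= hsqn d x.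
Proof.
move=> pN; have [Ny h] := is_proj_oproj x pN.
rewrite -[X in _ <= hsqn d X](subrK (oproj d N x)) hsqnD h//= mulr0 addr0.
by rewrite lerDr hsqn_ge0.
Qed.

Lemma range_oproj N : lin_subspace N -> projectable N -> range (oproj d N) = N.
Proof.
move=> sN pN; apply/seteqP; split.
  by move=> _ [x _ <-]; exact: (is_proj_oproj x pN).1.
by move=> x Nx; exists x => //; exact: oproj_id.
Qed.

Definition ortho_family (T : finType) (e : T -> V) : Prop :=
  forall i j, d (e i) (e j) = (i == j)%:R.

Lemma ortho_comb (T : finType) (e : T -> V) c j :
  ortho_family e -> d (comb e c) (e j) = c j.
Proof.
move=> eo; rewrite /comb linear_sumlz (bigD1 j)//= linearZl_LR /= eo eqxx mulr1.
rewrite big1 ?addr0// => i /negbTE ij.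
by rewrite linearZl_LR /= eo ij mulr0.
Qed.

Lemma ortho_indep (T : finType) (e : T -> V) : ortho_family e -> indep e.
Proof. by move=> eo c c0 j; rewrite -(ortho_comb c j eo) c0 linear0l. Qed.

Lemma hsqn_comb (T : finType) (e : T -> V) c :
  ortho_family e -> hsqn d (comb e c) = \sum_i csq (c i).
Proof.
move=> eo; rewrite /hsqn {2}/comb linear_sumr.
rewrite (eq_bigr (fun i => (csq (c i))%:C)); last first.
  move=> i _; rewrite linearZr_LR /= ortho_comb//.
  case: (c i) => a b; apply/eqP; rewrite eq_complex /csq /=.
  by apply/andP; split; apply/eqP; ring.
by rewrite -rmorph_sum.
Qed.

(** A maximal orthonormal family of a finite dimensional subspace spans it. *)
Lemma ortho_basis N (T : finType) (b : T -> V) : lin_subspace N ->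
  N `<=` range (comb b) ->
  exists (p : nat) (e : 'I_p -> V), [/\ ortho_family e, forall i, N (e i) &
    forall x, N x -> x = comb e (fun i => d x (e i))].
Proof.
move=> sN Nb.
pose P p := `[< exists e : 'I_p -> V, ortho_family e /\ forall i, N (e i) >].
have exP : exists p, P p by exists 0%N; apply/asboolP; exists (fun=> 0); split; case.
have bdP p : P p -> (p <= #|T|)%N.
  move=> /asboolP [e [eo eN]]; rewrite -[X in (X <= _)%N]card_ord.
  by apply: (indep_card (ortho_indep eo)) => t; apply: Nb.
case: (ex_maxnP exP bdP) => p /asboolP [e [eo eN]] maxp.
exists p, e; split=> // x Nx; apply: contrapT => xe.
set y0 := comb e _ in xe; pose y := x - y0.
have Ny : N y by apply: subspaceB => //; exact: subspace_comb.
have ye i : d y (e i) = 0 by rewrite linearBl /= ortho_comb// subrr.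
have ey i : d (e i) y = 0 by rewrite dotC ye rmorph0.
have y0' : hsqn d y != 0.
  by apply: contra_notN xe => /eqP/hsqn_eq0/eqP; rewrite subr_eq0 => /eqP.
(* The normalized y would extend the maximal family. *)
have yy : d y y = (hsqn d y)%:C by exact: dot_sqn.
pose z := (hnorm d y)^-1%:C *: y.
have zz : d z z = 1.
  rewrite /z linearZl_LR linearZr_LR /= yy.
  rewrite (_ : Num.conj _ = (hnorm d y)^-1%:C); last first.
    by apply/eqP; rewrite eq_complex /= oppr0 !eqxx.
  rewrite -!rmorphM /= mulrA -expr2 /hnorm exprVn sqr_sqrtr ?hsqn_ge0//.
  by rewrite mulVf.
suff /maxp : P p.+1 by rewrite ltnn.
apply/asboolP; exists (fun i => if unlift ord_max i is Some j then e j else z).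
split=> [i j|i]; last first.
  by case: unliftP => [j _|_]; [exact: eN|exact: subspaceZ].
case: unliftP => [i' ->|->]; case: unliftP => [j' ->|->].
- by rewrite eo (inj_eq lift_inj).
- by rewrite linearZr_LR /= ey mulr0 eq_sym (negbTE (neq_lift _ _)).
- by rewrite linearZl_LR /= ye mulr0 (negbTE (neq_lift _ _)).
- by rewrite zz eqxx.
Qed.

Lemma fin_has_dim N (T : finType) (b : T -> V) : lin_subspace N ->
  N `<=` range (comb b) -> exists p, has_dim N p.
Proof.
move=> sN Nb; have [p [e [eo eN eE]]] := ortho_basis sN Nb.
exists #|'I_p|; apply: (basis_has_dim (ortho_indep eo)); apply/seteqP; split.
  by move=> _ [c _ <-]; exact: subspace_comb.
by move=> x Nx; rewrite (eE x Nx); exists (fun i => d x (e i)).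
Qed.

(** The projection is given by the Fourier coefficients in an orthonormal
    basis. *)
Lemma fin_projectable N (T : finType) (b : T -> V) : lin_subspace N ->
  N `<=` range (comb b) -> projectable N.
Proof.
move=> sN Nb x; have [p [e [eo eN eE]]] := ortho_basis sN Nb.
exists (comb e (fun i => d x (e i))); split; first exact: subspace_comb.
move=> z /eE ->; rewrite linear_sumr big1// => i _.
by rewrite linearZr_LR /= linearBl /= ortho_comb// subrr mulr0.
Qed.

Lemma fin_complete (T : finType) (b : T -> V) :
  setT `<=` range (comb b) -> hcomplete d.
Proof.
move=> Vb u uc; have sT : lin_subspace [set: V] by [].
have [p [e [eo _ eE]]] := ortho_basis sT Vb.
have {}eE x : x = comb e (fun i => d x (e i)) by exact: eE.
have [l lE] : {l : 'I_p -> R[i] & forall i,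
    (fun m => csq (d (u m) (e i) - l i)) @ \oo --> (0 : R)}.
  apply: (@choice _ _ (fun i l =>
    (fun m => csq (d (u m) (e i) - l)) @ \oo --> (0 : R))) => i.
  apply: complex_complete => r r0; have [n0 h] := uc r r0.
  exists n0 => m m' nm nm'; apply: le_lt_trans (h m m' nm nm').
  rewrite -linearBl; apply: le_trans (cauchy_schwarz _ _ _) _.
  by rewrite [X in _ * X]/hsqn eo eqxx mulr1.
exists (comb e l); rewrite /hlim.
rewrite (_ : (fun _ => _) = fun m => \sum_i csq (d (u m) (e i) - l i)); last first.
  apply/funext => m; rewrite {1}(eE (u m)) -(hsqn_comb _ eo); congr hsqn.
  by rewrite /comb -sumrB; apply: eq_bigr => i _; rewrite scalerBl.
exact: cvg_sum0.
Qed.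

End Projection.

(** * Square-summable families and creation operators *)

Section Sums.
Context {R : realType}.

Lemma nsum_ge_seq (I : choiceType) (g : I -> R) (s : seq I) :
  (forall i, 0 <= g i) -> rsummable g -> uniq s -> \sum_(i <- s) g i <= nsum g.
Proof.
move=> g0 sg us; rewrite -lee_fin -nsum_fin//; apply: esum_ge.
exists [set` s]; first by split=> //; exact: finite_seq.
by rewrite -fsbig_seq// sumEFin.
Qed.

Lemma nsum_le (I : choiceType) (g : I -> R) c : (forall i, 0 <= g i) ->
  (forall s : seq I, uniq s -> \sum_(i <- s) g i <= c) ->
  rsummable g /\ nsum g <= c.
Proof.
move=> g0 gc; have h : (\esum_(i in [set: I]) (g i)%:E <= c%:E)%E.
  apply: ge_ereal_sup => _ [X [fX _] <-].
  by rewrite fsbig_finite// sumEFin lee_fin gc// fset_uniq.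
have sg : rsummable g.
  apply: le_lt_trans (ltry c); apply: le_trans h; apply: le_esum => i _ /=.
  by rewrite ger0_norm.
by split=> //; rewrite -lee_fin -nsum_fin.
Qed.

Lemma nsum_reindex (I J : choiceType) (phi : I -> J) (g : J -> R) :
  injective phi -> (forall j, ~ range phi j -> g j = 0) ->
  nsum g = nsum (g \o phi).
Proof.
move=> phi_inj g0; rewrite /nsum; congr fine.
rewrite (eq_esum (b := fun j => if j \in range phi then (g j)%:E else 0%E)).
  by rewrite -esum_mkcond esum_image// => ? ? _ _; exact: phi_inj.
by move=> j _; case: ifPn => // /negP; rewrite inE => /g0 ->.
Qed.

(** A family supported on the image of an injection, such as a vector in
    the range of a creation operator, is summed along that injection. *)
Lemma csum_reindex (I J : choiceType) (phi : I -> J) (f : J -> R[i]) :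
  injective phi -> (forall j, ~ range phi j -> f j = 0) ->
  csum f = csum (f \o phi).
Proof.
move=> phi_inj f0; rewrite /csum /rsum; congr (_ +i* _); congr (_ - _);
  by apply: nsum_reindex => // j /f0 ->; rewrite /= ?oppr0 maxxx.
Qed.

Lemma rsummable_comp (I J : choiceType) (phi : I -> J) (g : J -> R) :
  injective phi -> rsummable g -> rsummable (g \o phi).
Proof.
move=> phi_inj sg; rewrite /rsummable /summable.
rewrite -(esum_image _ _ (fun j => `|(g j)%:E|%E)); last first.
  by move=> ? ? _ _; exact: phi_inj.
apply: le_lt_trans sg; rewrite esum_mkcond; apply: le_esum => j _.
by case: ifP.
Qed.

End Sums.

Section Ell2Theory.
Context {R : realType} {E : lmodType R[i]} (I : choiceType)
  (dE : {dot E for Num.conj}).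
Implicit Types (f g : ell2 I dE).
Local Notation dI := (ell2_dot I dE).

Lemma ell2_summable f : rsummable (fun i => hsqn dE (f i)).
Proof. exact: asboolW (ell2_valP f). Qed.

Lemma hsqn_ell2 f : hsqn dI f = nsum (fun i => hsqn dE (f i)).
Proof.
rewrite -rsum_ge0//; first by move=> i; exact: hsqn_ge0.
exact: ell2_summable.
Qed.

Lemma hsqn_ell2_ge f (s : seq I) : uniq s ->
  \sum_(i <- s) hsqn dE (f i) <= hsqn dI f.
Proof.
move=> us; rewrite hsqn_ell2; apply: nsum_ge_seq => //.
  by move=> i; exact: hsqn_ge0.
exact: ell2_summable.
Qed.

Lemma ell2P f g : (forall i, f i = g i) -> f = g.
Proof. by move=> h; apply/val_inj/funext. Qed.

(** Coordinatewise limits exist because E is complete; a bound on the finite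
    partial sums of |u m - u m'|^2 that is uniform in m' passes to the limit
    m' -> oo.  Only the quasi-triangle inequality
    |a + b|^2 <= 2 |a|^2 + 2 |b|^2 is used, whence the factor 2. *)
Theorem ell2_complete : hcomplete dE -> hcomplete dI.
Proof.
move=> cE u uc.
have uBE m m' i : (u m - u m') i = u m i - u m' i by [].
have coord i m m' : hsqn dE (u m i - u m' i) <= hsqn dI (u m - u m').
  by have := @hsqn_ell2_ge (u m - u m') [:: i] isT; rewrite big_seq1.
have [x xE] : {x : I -> E & forall i, hlim dE (fun m => u m i) (x i)}.
  apply: (@choice _ _ (fun i y => hlim dE (fun m => u m i) y)) => i.
  apply: cE => e /uc [n0 h]; exists n0 => m m' nm nm'.
  exact: le_lt_trans (coord i m m') (h _ _ nm nm').
have tail e : 0 < e -> exists n0, forall m, (n0 <= m)%N ->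
    rsummable (fun i => hsqn dE (u m i - x i)) /\
    nsum (fun i => hsqn dE (u m i - x i)) <= 2 * e.
  move=> /uc [n0 h]; exists n0 => m nm.
  apply: nsum_le => [i|s us]; first exact: hsqn_ge0.
  pose f m' : R := 2 * e + 2 * \sum_(i <- s) hsqn dE (u m' i - x i).
  have fl : f @ \oo --> (2 * e + 2 * 0 : R).
    apply: cvgD; first exact: cvg_cst.
    by apply: cvgMr; apply: cvg_sum0 => i; exact: xE.
  rewrite mulr0 addr0 in fl; apply: (cvgr_to_ge fl); near=> m'.
  have nm' : (n0 <= m')%N by near: m'; exact: nbhs_infty_ge.
  apply: (@le_trans _ _ (\sum_(i <- s) (2 * hsqn dE (u m i - u m' i) +
      2 * hsqn dE (u m' i - x i)))).
    apply: ler_sum => i _.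
    by rewrite -[u m i - x i](subrKA (u m' i)); exact: hsqnD_le.
  rewrite big_split /= -!mulr_sumr /f lerD2r ler_pM2l//.
  apply: le_trans (ltW (h _ _ nm nm')).
  exact: (hsqn_ell2_ge (u m - u m') us).
have [n0 /(_ n0 (leqnn _)) [sx _]] := tail 1 ltr01.
have xP : x \in ell2_pred dE.
  apply/asboolP; apply: rsummable_le (rsummableD (rsummableZ 2 sx)
    (rsummableZ 2 (ell2_summable (u n0)))) => i.
  rewrite ger0_norm ?hsqn_ge0// -{1}(subrK (u n0 i) (x i)).
  by rewrite (hsqnBC dE (u n0 i)); exact: hsqnD_le.
exists (Ell2 xP); apply/cvgrPdist_le => e e0.
have e20 : 0 < e / 2 by rewrite divr_gt0.
have [n1 h] := tail _ e20; exists n1 => // m /h [_ {}h].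
rewrite sub0r normrN ger0_norm ?hsqn_ge0// hsqn_ell2.
by apply: le_trans h _; rewrite mulrC divfK.
Unshelve. all: by end_near. Qed.

End Ell2Theory.

Section Creation.
Context {R : realType} {E : lmodType R[i]} (k : nat) (n : 'I_k -> nat)
  (dE : {dot E for Num.conj}).
Local Notation dF := (fock_dot n dE).
Implicit Types (f g : fock n dE).

Fact annihilation_subproof (i : 'I_k) (j : 'I_(n i)) f :
  (fun w => f (cons_word j w)) \in ell2_pred dE.
Proof.
apply/asboolP; apply: (@rsummable_comp _ _ _ (cons_word j) (fun w => hsqn dE (f w))).
  exact: cons_word_inj.
exact: ell2_summable.
Qed.

(** The adjoint of the creation operator. *)
Definition annihilation (i : 'I_k) (j : 'I_(n i)) f : fock n dE :=
  Ell2 (annihilation_subproof j f).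

Lemma creation_adjoint (i : 'I_k) (j : 'I_(n i)) f g :
  dF (creation dE i j f) g = dF f (annihilation j g).
Proof.
rewrite /= /ell2_dot (csum_reindex (phi := cons_word j)).
- by congr csum; apply/funext => w /=; rewrite creation_fun_cons.
- exact: cons_word_inj.
- by move=> w /creation_fun_notin h; rewrite /= h linear0l.
Qed.

Lemma annihilationK (i : 'I_k) (j : 'I_(n i)) f :
  annihilation j (creation dE i j f) = f.
Proof. by apply: ell2P => w; rewrite /= creation_fun_cons. Qed.

Lemma hsqn_creation (i : 'I_k) (j : 'I_(n i)) f :
  hsqn dF (creation dE i j f) = hsqn dF f.
Proof.
rewrite /hsqn; congr (complex.Re _).
by apply: etrans (creation_adjoint _ _ _) _; rewrite annihilationK.
Qed.

Lemma creation_linear (i : 'I_k) (j : 'I_(n i)) : linear (creation dE i j).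
Proof.
move=> a f g; apply: ell2P => w /=; rewrite /creation_fun.
rewrite [RHS](_ : _ = a *: creation_fun j f w + creation_fun j g w)//.
rewrite /creation_fun; case: (w i) => [|j' s]; first by rewrite scaler0 addr0.
by case: eqP; rewrite // scaler0 addr0.
Qed.

End Creation.

(** * Words and the defect of the creation operators *)

Section Words.
Context {k : nat} {n : 'I_k -> nat}.
Implicit Types (w : word n) (q : k.-tuple nat).

Definition empty_word : word n := finfun (fun i : 'I_k => [::] : seq 'I_(n i)).

Lemma cons_word_in (i : 'I_k) (j : 'I_(n i)) w : cons_word j w i = j :: w i.
Proof. by rewrite /cons_word ffunE dfwith_in. Qed.

Lemma cons_word_out (i : 'I_k) (j : 'I_(n i)) w l :
  l != i -> cons_word j w l = w l.
Proof. by move=> li; rewrite /cons_word ffunE dfwith_out// eq_sym. Qed.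

Lemma cons_wordC s t (i : 'I_(n s)) (j : 'I_(n t)) w : s != t ->
  cons_word i (cons_word j w) = cons_word j (cons_word i w).
Proof.
move=> st; apply/ffunP => l.
have [->|ls] := eqVneq l s.
  by rewrite cons_word_in cons_word_out// cons_word_out// cons_word_in.
have [->|lt] := eqVneq l t.
  by rewrite cons_word_out ?cons_word_in// ?cons_word_out// eq_sym.
by rewrite !cons_word_out.
Qed.

Lemma uncons_word (i : 'I_k) w j r : w i = j :: r ->
  exists2 w', w = cons_word j w' & forall l, l != i -> w' l = w l.
Proof.
move=> wi; exists (finfun (eqtype.dfwith (T := fun l => seq 'I_(n l)) w r)).
  apply/ffunP => l; have [->|li] := eqVneq l i.
    by rewrite cons_word_in wi ffunE dfwith_in.
  by rewrite cons_word_out// ffunE dfwith_out// eq_sym.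
by move=> l li; rewrite ffunE dfwith_out// eq_sym.
Qed.

Lemma foldr_cons_in (i : 'I_k) (s : seq 'I_(n i)) w :
  foldr (fun j => cons_word (i := i) j) w s i = s ++ w i.
Proof. by elim: s => [//|j s IH]; rewrite /= cons_word_in IH. Qed.

Lemma foldr_cons_out (i : 'I_k) (s : seq 'I_(n i)) w l : l != i ->
  foldr (fun j => cons_word (i := i) j) w s l = w l.
Proof. by move=> li; elim: s => [//|j s IH]; rewrite /= cons_word_out. Qed.

Lemma word_fold w :
  foldr (fun (i : 'I_k) v => foldr (fun j => cons_word (i := i) j) v (w i))
    empty_word (enum 'I_k) = w.
Proof.
suff h (s : seq 'I_k) l : uniq s ->
    foldr (fun (i : 'I_k) v => foldr (fun j => cons_word (i := i) j) v (w i))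
      empty_word s l = if l \in s then w l else [::].
  by apply/ffunP => l; rewrite h ?enum_uniq// mem_enum.
elim: s l => [|i s IH] l; first by rewrite /= ffunE.
rewrite cons_uniq => /andP[iNs us]; rewrite in_cons.
have [->|li] := eqVneq l i.
  by rewrite [LHS]foldr_cons_in IH// (negbTE iNs) cats0.
by rewrite [LHS]foldr_cons_out// IH.
Qed.

End Words.

Section FockTheory.
Context {R : realType} {E : lmodType R[i]} {k : nat} {n : 'I_k -> nat}
  (dE : {dot E for Num.conj}).
Local Notation dF := (fock_dot n dE).
Implicit Types (f g : fock n dE) (w : word n).

Lemma fockB f g w : (f - g) w = f w - g w. Proof. by []. Qed.
Lemma fockZ a f w : (a *: f) w = a *: f w. Proof. by []. Qed.

Lemma fock_sum (T : Type) (r : seq T) (F : T -> fock n dE) w :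
  (\sum_(t <- r) F t) w = \sum_(t <- r) F t w.
Proof. by elim/big_rec2: _ => // t x y _ <-. Qed.

Lemma csum_unit (f : unit -> R[i]) : csum f = f tt.
Proof.
have nsum_unit (g : unit -> R) : (forall u, 0 <= g u) -> nsum g = g tt.
  move=> g0; rewrite /nsum (_ : [set: unit] = [set tt]); last first.
    by apply/seteqP; split; case.
  by rewrite esum_set1// lee_fin.
have rsum_unit (g : unit -> R) : rsum g = g tt.
  rewrite /rsum !nsum_unit; [|by move=> u; rewrite le_max lexx orbT..].
  by case: (leP (g tt) 0) => g0; case: (leP (- g tt) 0) => g1;
    rewrite ?opprK ?subr0 ?add0r//; move: g0 g1; lra.
by rewrite /csum !rsum_unit; case: (f tt).
Qed.

Lemma dot_etensor w (x : E) f : dF (etensor dE w x) f = dE x (f w).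
Proof.
rewrite /= /ell2_dot (csum_reindex (phi := fun _ : unit => w)).
- by rewrite csum_unit /= eqxx.
- by move=> [] [].
move=> v vw /=; case: eqP => [vw'|_]; last by rewrite linear0l.
by case: vw; exists tt.
Qed.

Lemma etensor_linear w : linear (@etensor R E k n dE w).
Proof.
move=> a x y; apply: ell2P => v /=.
rewrite [RHS](_ : _ = a *: etensor dE w x v + etensor dE w y v)//=; case: eqP => // _.
by rewrite scaler0 addr0.
Qed.

Lemma fock_eq f g : (forall h, dF f h = dF g h) -> f = g.
Proof.
move=> fg; apply/eqP; rewrite -subr_eq0; apply/eqP.
apply: (@dot_nondeg _ _ dF) => h; rewrite linearBl.
by apply/eqP; rewrite subr_eq0; apply/eqP; exact: fg.
Qed.

Lemma creationC s t (i : 'I_(n s)) (j : 'I_(n t)) f : s != t ->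
  creation dE s i (creation dE t j f) = creation dE t j (creation dE s i f).
Proof.
move=> st; apply: fock_eq => h.
rewrite !creation_adjoint; congr ell2_dot; apply: ell2P => w /=.
by rewrite cons_wordC// eq_sym.
Qed.

(** The defect of the uncompressed creation operators, built one factor at a
    time and with the explicit adjoints. *)
Definition fock_defect (s : seq 'I_k) : fock n dE -> fock n dE :=
  foldr (fun (i : 'I_k) Y f =>
    Y f - \sum_(j < n i) creation dE i j (Y (annihilation j f))) id s.

Lemma fock_defect_cons i s f : fock_defect (i :: s) f =
  fock_defect s f - \sum_(j < n i) creation dE i j (fock_defect s (annihilation j f)).
Proof. by []. Qed.

(** Subtracting the terms of the factor i removes exactly the coefficients
    at the words whose i-th letter sequence is nonempty: such a word is
    j :: r in its i-th place for exactly one j. *)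
Lemma fock_defectE (s : seq 'I_k) f w : uniq s ->
  fock_defect s f w = if all (fun i => w i == [::]) s then f w else 0.
Proof.
elim: s f w => [//|i s IH] f w; rewrite cons_uniq => /andP[iNs us].
rewrite fock_defect_cons fockB fock_sum IH//; rewrite [all _ (i :: s)]/=.
case wi: (w i) => [|j r] /=.
  rewrite big1 ?subr0// => j _ /=.
  by rewrite /creation_fun wi.
have [w' ww' w'E] := uncons_word wi.
rewrite (bigD1 j)//= big1 ?addr0; last first.
  move=> j' j'j; rewrite /creation_fun wi; case: eqP => // jj'.
  by rewrite jj' eqxx in j'j.
rewrite ww' creation_fun_cons IH//= -ww'.
rewrite [X in if X then _ else _](_ : _ = all (fun i => w' i == [::]) s).
  by rewrite subrr.
apply: eq_in_all => l ls; rewrite w'E//.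
by apply: contraNneq iNs => <-.
Qed.

Lemma fock_defect_vacuum f :
  fock_defect (enum 'I_k) f = etensor dE empty_word (f empty_word).
Proof.
apply: ell2P => w; rewrite fock_defectE ?enum_uniq//=.
case: eqP => [->|we].
  by case: ifPn => // /allPn [i _]; rewrite ffunE.
case: ifPn => // /allP h; case: we; apply/ffunP => i.
by rewrite ffunE; apply/eqP/h; rewrite mem_enum.
Qed.

Lemma word_op_etensor w (x : E) :
  word_op (creation dE) w (etensor dE empty_word x) = etensor dE w x.
Proof.
rewrite /word_op -{2}(word_fold w).
elim: (enum 'I_k) => [//|i s IH].
apply: etrans (f_equal (fun v => foldr (fun j => creation dE i j) v (w i)) IH) _.
rewrite [in RHS]/=; move: (foldr _ empty_word s) => v.
elim: (w i) => [//|j r IHr].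
apply: etrans (f_equal (creation dE i j) IHr) _.
exact: creation_etensor.
Qed.

End FockTheory.

(** * The compressions to the orthogonal complement *)

Section Compression.
Context {R : realType} {E : lmodType R[i]} {k : nat} {n : 'I_k -> nat}
  (dE : {dot E for Num.conj}) (M : set (fock n dE)).
Local Notation dF := (fock_dot n dE).
Local Notation Mp := [set` orthc dF M].
Local Notation P := (oproj dF Mp).
Local Notation dM := (orth_dot dF M).
Local Notation S := (creation dE).
Local Notation T := (fun i j => compress dF M (S i j)).
Context (cF : hcomplete dF) (invM : creation_invariant M).
Implicit Types (f g : fock n dE) (x y : orth dF M).

Lemma orthc_projectable : projectable dF Mp.
Proof. by move=> f; exact: orthc_projection. Qed.

Let pM := orthc_projectable.
Let sM : lin_subspace Mp := orthc_subspace dF M.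

Lemma proj_orthc f : Mp (P f).
Proof. exact: (is_proj_oproj f pM).1. Qed.

Lemma proj_linear : linear P.
Proof. exact: oproj_linear. Qed.

Lemma annihilation_orthc (i : 'I_k) (j : 'I_(n i)) f :
  Mp f -> Mp (annihilation j f).
Proof.
move=> /orthcP Mf; apply/orthcP => g Mg.
apply: dot_eq0C; apply: etrans (esym (creation_adjoint j g f)) _.
by apply: dot_eq0C; apply: Mf; exact: invM.
Qed.

(** M^perp is invariant under the adjoints of the creation operators, so
    ker P is invariant under the creation operators. *)
Lemma proj_creation (i : 'I_k) (j : 'I_(n i)) f : P (S i j (P f)) = P (S i j f).
Proof.
apply: oproj_eq => //; split; first exact: proj_orthc.
move=> g Mg; have h : dF (P f) (annihilation j g) = dF f (annihilation j g).
  by apply: (oproj_orth _ pM); exact: annihilation_orthc.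
rewrite linearBl /= oproj_orth// !creation_adjoint h.
by apply/eqP; rewrite subr_eq0 eq_sym; apply/eqP; exact: creation_adjoint.
Qed.

Lemma orth_val_linear : linear (val : orth dF M -> fock n dE).
Proof. by move=> a x y; rewrite linearP. Qed.

Lemma val_compress A x : val (compress dF M A x) = P (A (val x)).
Proof. by rewrite /compress val_insubd (proj_orthc _). Qed.

Lemma proj_val x : P (val x) = val x.
Proof. by apply: oproj_id => //; exact: orth_valP. Qed.

Lemma hsqn_orth x : hsqn dM x = hsqn dF (val x).
Proof. by []. Qed.

Lemma orth_valB x y : val (x - y) = val x - val y.
Proof. by rewrite raddfB. Qed.

Lemma orth_complete : hcomplete dM.
Proof.
move=> u uc; have [f uf] : exists f, hlim dF (fun m => val (u m)) f.
  apply: cF => e /uc [n0 h]; exists n0 => p q np nq.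
  by rewrite -orth_valB -hsqn_orth h.
have Mf : f \in orthc dF M.
  by apply: (orthc_closed _ uf) => m; exact: orth_valP.
exists (Orth Mf); rewrite /hlim.
rewrite (_ : (fun m => _) = (fun m => hsqn dF (val (u m) - f))).
  exact: uf.
by apply/funext => m; rewrite hsqn_orth orth_valB.
Qed.

Lemma compress_linear (i : 'I_k) (j : 'I_(n i)) : linear (T i j).
Proof.
move=> a x y; apply: val_inj.
transitivity (a *: P (S i j (val x)) + P (S i j (val y))).
  apply: etrans (val_compress _ _) _.
  by rewrite (orth_val_linear a x y) creation_linear proj_linear.
apply: etrans _ (esym (orth_val_linear a (T i j x) (T i j y))).
by congr (a *: _ + _); apply: esym; exact: val_compress.
Qed.

Lemma compress_bounded (i : 'I_k) (j : 'I_(n i)) : bounded_linear dM (T i j).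
Proof.
split; first exact: compress_linear.
exists 1 => x; rewrite mul1r /hnorm ler_wsqrtr// !hsqn_orth val_compress.
by rewrite -(hsqn_creation j (val x)); exact: oproj_le.
Qed.

Lemma compress_comm s t (i : 'I_(n s)) (j : 'I_(n t)) : s != t ->
  T s i \o T t j = T t j \o T s i.
Proof.
have TT (a b : 'I_k) (p : 'I_(n a)) (q : 'I_(n b)) x :
    val (T a p (T b q x)) = P (S a p (S b q (val x))).
  apply: etrans (val_compress _ _) _.
  by rewrite (val_compress (S b q) x) proj_creation.
move=> st; apply/funext => x; apply: val_inj.
apply: etrans (TT _ _ _ _ _) _; apply: etrans _ (esym (TT _ _ _ _ _)).
by rewrite creationC.
Qed.

Lemma compress_adjoint (i : 'I_k) (j : 'I_(n i)) y :
  val (adjoint dM (T i j) y) = annihilation j (val y).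
Proof.
have My : annihilation j (val y) \in orthc dF M.
  by apply: annihilation_orthc; exact: orth_valP.
have adj x : dM (T i j x) y = dM x (Orth My).
  rewrite /orth_dot val_compress [LHS]oproj_orth//; last exact: orth_valP.
  exact: creation_adjoint.
rewrite /adjoint; case: xgetP => [z _ zE|/(_ (Orth My))//].
suff -> : z = Orth My by [].
apply/eqP; rewrite -subr_eq0; apply/eqP; apply: (@dot_nondeg _ _ dM) => x.
apply: dot_eq0C; rewrite linearBr; apply/eqP; rewrite subr_eq0; apply/eqP.
exact: etrans (esym (zE x)) (adj x).
Qed.

(** By [proj_creation] the inner projections disappear from each term
    M_(i,j) Y M_(i,j)^*, which leaves the compression of the defect of the
    creation operators. *)
Lemma val_defect x : val (defect dM T x) =
  P (etensor dE empty_word (val x empty_word)).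
Proof.
rewrite -fock_defect_vacuum /defect; elim: (enum 'I_k) x => [|i s IH] x.
  by rewrite /= proj_val.
rewrite fock_defect_cons; set D := foldr _ _ s in IH.
rewrite [foldr _ _ _](_ : _ = fun x => D x - Phi dM T i D x)//.
rewrite (linear_funB orth_val_linear) IH linear_funB; last exact: proj_linear.
congr (_ - _); rewrite /Phi.
rewrite (linear_fun_sum _ orth_val_linear) (linear_fun_sum _ proj_linear).
by apply: eq_bigr => j _; rewrite val_compress IH compress_adjoint proj_creation.
Qed.

Lemma val_word_op (w : word n) x f : val x = P f ->
  val (word_op T w x) = P (word_op S w f).
Proof.
have letters (i : 'I_k) (r : seq 'I_(n i)) y g : val y = P g ->
    val (foldr (T i) y r) = P (foldr (S i) g r).
  move=> yg; elim: r => [//|j r IH].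
  apply: etrans (val_compress (S i j) (foldr (T i) y r)) _.
  apply: etrans (f_equal (fun h => P (S i j h)) IH) _.
  exact: proj_creation.
rewrite /word_op => xf; elim: (enum 'I_k) => [//|i s IH].
exact: letters IH.
Qed.

End Compression.

(** * Ranks of the truncated projections *)

Section BoundedWords.
Context {k : nat} {n : 'I_k -> nat}.
Implicit Types (w : word n) (q : k.-tuple nat).

(** A finite type enumerating the words of multi-length at most q: each
    component is recorded with its length. *)
Definition bword q : finType :=
  {dffun forall i : 'I_k, {p : 'I_(tnth q i).+1 & p.-tuple 'I_(n i)}}.

Definition nwords q : nat :=
  (\prod_(i < k) \sum_(p < (tnth q i).+1) n i ^ p)%N.

Lemma card_bword q : #|bword q| = nwords q.
Proof.
rewrite card_dep_ffun foldrE big_map big_enum /=; apply: eq_bigr => i _.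
rewrite card_tagged sumnE big_map big_enum /=; apply: eq_bigr => p _.
by rewrite card_tuple card_ord.
Qed.

Definition word_of q (u : bword q) : word n :=
  finfun (fun i => tval (tagged (u i)) : seq 'I_(n i)).

Lemma word_of_inj q : injective (@word_of q).
Proof.
move=> u v /ffunP uv; apply/ffunP => i; have := uv i; rewrite !ffunE.
case: (u i) (v i) => [p s] [p' s'] /= ss'.
have pp' : p = p' by apply: val_inj; rewrite /= -(size_tuple s) ss' size_tuple.
by subst p'; congr Tagged; exact: val_inj.
Qed.

Lemma word_of_le q (u : bword q) : word_le (word_of u) q.
Proof. by move=> i; rewrite ffunE size_tuple -ltnS. Qed.

Lemma word_leP w q : word_le w q -> exists u : bword q, w = word_of u.
Proof.
move=> wq; have wq' i : (size (w i) < (tnth q i).+1)%N by rewrite ltnS.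
exists (finfun (fun i => Tagged (fun p : 'I_(tnth q i).+1 => p.-tuple 'I_(n i))
  (in_tuple (w i) : (Ordinal (wq' i)).-tuple 'I_(n i)))).
by apply/ffunP => i; rewrite !ffunE.
Qed.

End BoundedWords.

Section BoundedFock.
Context {R : realType} {E : lmodType R[i]} {k : nat} {n : 'I_k -> nat}
  (dE : {dot E for Num.conj}) {TE : finType} (b : TE -> E).
Local Notation dF := (fock_dot n dE).
Context (bi : indep b) (bT : setT `<=` range (comb b)).
Implicit Types (f g : fock n dE) (q : k.-tuple nat).

(** The space V_q. *)
Definition fock_le q : set (fock n dE) :=
  lspan [set f | exists w x, word_le w q /\ f = etensor dE w x].

Definition fock_basis q (t : bword q * TE) : fock n dE :=
  etensor dE (word_of t.1) (b t.2).

Lemma fock_basis_indep q : indep (@fock_basis q).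
Proof.
move=> c c0 [u t]; apply: (bi (c := fun t => c (u, t))).
have := congr1 (fun f : fock n dE => f (word_of u)) c0.
rewrite /comb fock_sum (eq_bigr (fun p : bword q * TE =>
    if p.1 == u then c (u, p.2) *: b p.2 else 0)); last first.
  move=> [u' t'] _; rewrite fockZ /= (inj_eq (@word_of_inj _ _ q)) eq_sym.
  by case: eqP => [->//|_]; rewrite scaler0.
rewrite -(pair_bigA _ (fun u' t' => if u' == u then c (u, t') *: b t' else 0)) /=.
by rewrite (bigD1 u)//= eqxx [X in _ + X]big1 ?addr0// => u' /negbTE ->; rewrite big1.
Qed.

Lemma range_fock_basis q : range (comb (@fock_basis q)) = fock_le q.
Proof.
apply/seteqP; split.
  move=> _ [c _ <-]; apply: lspanP => -[u t].
  by exists (word_of u), (b t); split=> //; exact: word_of_le.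
apply: lspan_min; first exact: subspace_range.
move=> _ [w [x [/word_leP [u ->] ->]]].
have [c _ <-] := bT (I : setT x).
rewrite (linear_comb _ _ (@etensor_linear _ _ _ _ dE (word_of u))).
apply: subspace_comb; first exact: subspace_range.
by move=> t; exact: (mem_comb (@fock_basis q) (u, t)).
Qed.

Lemma fock_le_dim q : has_dim (fock_le q) (nwords (n := n) q * #|TE|).
Proof.
rewrite -card_bword -card_prod; apply: basis_has_dim (@fock_basis_indep q) _.
exact: range_fock_basis.
Qed.

Lemma fock_le_subspace q : lin_subspace (fock_le q).
Proof. exact: subspace_lspan. Qed.

Lemma range_Ple q : range (Ple dE q) = fock_le q.
Proof.
apply: range_oproj; first exact: fock_le_subspace.
apply: (@fin_projectable _ _ _ _ _ (@fock_basis q)); first exact: fock_le_subspace.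
by rewrite range_fock_basis.
Qed.

Lemma op_rank_Ple q : op_rank (Ple (n := n) dE q) = (nwords (n := n) q * #|TE|)%N.
Proof. by rewrite /op_rank range_Ple; apply: fdimE; exact: fock_le_dim. Qed.

End BoundedFock.

Arguments fock_le {R E k n} dE q _.

Section CoinvariantRank.
Context {R : realType} {E : lmodType R[i]} {k : nat} {n : 'I_k -> nat}
  (dE : {dot E for Num.conj}) {TE : finType} (b : TE -> E)
  (M : set (fock n dE)).
Local Notation dF := (fock_dot n dE).
Local Notation Mp := [set` orthc dF M].
Local Notation P := (oproj dF Mp).
Local Notation dM := (orth_dot dF M).
Local Notation S := (creation dE).
Local Notation T := (fun i j => compress dF M (S i j)).
Context (bi : indep b) (bT : setT `<=` range (comb b)).
Context (invM : creation_invariant M).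
Implicit Types (f g : fock n dE) (x y : orth dF M) (q : k.-tuple nat).

Lemma fock_complete : hcomplete dF.
Proof. exact: (ell2_complete (fin_complete bT)). Qed.

Let cF := fock_complete.
Let pM := orthc_projectable M cF.
Let sM : lin_subspace Mp := orthc_subspace dF M.

(** With A the evaluation of f in M^perp at the empty word, the defect is
    A^* A and P (e_() (x) x) = A^* x.  Since E is finite dimensional, x can be
    replaced by its projection onto the range of A, as A^* vanishes on the
    orthogonal complement of that range. *)
Lemma range_defect :
  range (defect dM T) = [set x | exists e, val x = P (etensor dE empty_word e)].
Proof.
apply/seteqP; split.
  by move=> _ [x _ <-]; exists (val x empty_word); exact: val_defect.
move=> x [e xe]; pose A := [set f empty_word | f in Mp].
have sA : lin_subspace A.
  by apply: (@subspace_image _ _ _ (fun f : fock n dE => f empty_word)).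
have pA : projectable dE A.
  by apply: (@fin_projectable _ _ _ _ _ b) => // y _; exact: bT.
have [e' [[f Mf fe'] he']] := pA e.
exists (Orth Mf) => //; apply: val_inj; apply: etrans (val_defect cF invM _) _.
apply: etrans _ (esym xe); rewrite /= fe'; apply: esym; apply: oproj_eq => //.
split; first exact: proj_orthc.
move=> g Mg; rewrite linearBl; apply/eqP; rewrite subr_eq0; apply/eqP.
rewrite [RHS](oproj_orth _ pM Mg).
have ee' : dE e (g empty_word) = dE e' (g empty_word).
  by apply/eqP; rewrite -subr_eq0 -linearBl; apply/eqP; apply: he'; exists g.
rewrite [LHS](dot_etensor empty_word e g) ee'; apply: esym.
exact: dot_etensor.
Qed.

Lemma finite_rank_defect : finite_rank (defect dM T).
Proof.
have sv : linear (val : orth dF M -> fock n dE) by exact: orth_val_linear.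
pose g e : fock n dE := P (etensor dE empty_word e).
have gl : linear g.
  by move=> a e e'; rewrite /g etensor_linear (proj_linear M cF).
have gE : val @` range (defect dM T) = range g.
  rewrite range_defect; apply/seteqP; split.
    by move=> _ [x [e xe] <-]; exists e.
  move=> _ [e _ <-].
  by exists (Orth (proj_orthc M cF (etensor dE empty_word e))) => //; exists e.
have sg : lin_subspace (range g) by exact: subspace_image.
have [|m hm] := fin_has_dim dF (b := g \o b) sg.
  move=> _ [e _ <-]; have [c _ <-] := bT (I : setT e).
  by rewrite (linear_comb _ _ gl); exists c.
exists m; apply: (has_dim_preimage (f := val) sv).
- by move=> x x0; apply: val_inj.
- rewrite range_defect; split.
    exists 0; rewrite (linear_fun0 (etensor_linear _ _)).
    by rewrite (linear_fun0 (proj_linear M cF)).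
  move=> a x y [e xe] [e' ye']; exists (a *: e + e').
  by rewrite etensor_linear (proj_linear M cF) -xe -ye'.
- by rewrite gE.
Qed.

Lemma image_Mspace q : val @` Mspace dM T q = P @` fock_le dE q.
Proof.
rewrite /Mspace (image_lspan _ (@orth_val_linear _ _ _ _ _ M)).
rewrite (image_lspan _ (proj_linear M cF)).
congr lspan; apply/seteqP; split.
  move=> _ [_ [w [h [wq hh ->]]] <-].
  move: hh; rewrite range_defect => -[e he].
  exists (etensor dE w e); first by exists w, e.
  apply: etrans _ (esym (val_word_op cF invM w he)).
  exact: (f_equal P (esym (word_op_etensor dE w e))).
move=> _ [_ [w [e [wq ->]]] <-].
pose h : orth dF M := Orth (proj_orthc M cF (etensor dE empty_word e)).
exists (word_op T w h).
  by exists w, h; split=> //; rewrite range_defect; exists e.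
have hP : val h = P (etensor dE empty_word e) by [].
apply: etrans (val_word_op cF invM w hP) _.
exact: (f_equal P (word_op_etensor dE w e)).
Qed.

(** V_q /\ ker P: for closed M, the part of M supported on the words of
    multi-length at most q. *)
Definition fock_ker q : set (fock n dE) := fock_le dE q `&` [set f | P f = 0].

Lemma fock_ker_fin q : exists m, has_dim (fock_ker q) m.
Proof.
apply: (fin_has_dim dF (b := @fock_basis _ _ _ n dE _ b q)).
  apply: subspaceI; first exact: fock_le_subspace.
  split; first exact: linear_fun0 (proj_linear M cF).
  by move=> a f g; rewrite /= (proj_linear M cF) => -> ->; rewrite scaler0 addr0.
by rewrite range_fock_basis// => f [].
Qed.

Lemma proj_image_dim q m : has_dim (fock_ker q) m ->
  has_dim (P @` fock_le dE q) (nwords (n := n) q * #|TE| - m).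
Proof.
move=> hm.
have sP : lin_subspace (P @` fock_le dE q).
  by apply: subspace_image (proj_linear M cF) _; exact: fock_le_subspace.
have [|r hr] := fin_has_dim dF (b := P \o @fock_basis _ _ _ n dE _ b q) sP.
  move=> _ [f qf <-]; move: qf; rewrite -(range_fock_basis dE bT) => -[c _ <-].
  by rewrite (linear_comb _ _ (proj_linear M cF)); exists c.
have := rank_nullity (proj_linear M cF) (fock_le_subspace dE q) hm hr.
by move=> /(has_dim_uniq (fock_le_dim dE bi bT q)) ->; rewrite addKn.
Qed.

Lemma rank_proj_Ple q m : has_dim (fock_ker q) m ->
  op_rank (P \o Ple dE q) = (nwords (n := n) q * #|TE| - m)%N.
Proof.
move=> /proj_image_dim; rewrite /op_rank -(range_Ple dE bT q) image_comp.
exact: fdimE.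
Qed.

Lemma dim_Mspace q m : has_dim (fock_ker q) m ->
  fdim (Mspace dM T q) = (nwords (n := n) q * #|TE| - m)%N.
Proof.
move=> /proj_image_dim; rewrite -image_Mspace => h; apply: fdimE.
apply: (has_dim_preimage (f := val) _ _ _ h).
- exact: orth_val_linear.
- by move=> x x0; apply: val_inj.
- exact: subspace_lspan.
Qed.

Lemma fock_le_creation q q' (i : 'I_k) (j : 'I_(n i)) f :
  tnth q' i = (tnth q i).+1 -> (forall l, l != i -> tnth q' l = tnth q l) ->
  fock_le dE q f -> fock_le dE q' (S i j f).
Proof.
move=> qi ql qf; suff : S i j @` fock_le dE q `<=` fock_le dE q'.
  by apply; exists f.
rewrite (image_lspan _ (creation_linear j)).
apply: lspan_min; first exact: fock_le_subspace.
move=> _ [_ [w [e [wq ->]]] <-]; rewrite creation_etensor; apply: lspan_gen.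
exists (cons_word j w), e; split=> // l.
have [->|li] := eqVneq l i; first by rewrite cons_word_in qi /= ltnS.
by rewrite cons_word_out// ql.
Qed.

(** The families S_(i,j) e, for e a basis of V_q /\ ker P and j < n i, are
    jointly independent because reading a combination of them at the words
    j w recovers the combination of e with the coefficients of that j. *)
Lemma fock_ker_growth q q' (i : 'I_k) m m' :
  tnth q' i = (tnth q i).+1 -> (forall l, l != i -> tnth q' l = tnth q l) ->
  has_dim (fock_ker q) m -> has_dim (fock_ker q') m' -> (n i * m <= m')%N.
Proof.
move=> qi ql /has_dim_basis [e [ei eN]] hm'.
rewrite -[X in (X * _)%N]card_ord -[X in (_ * X)%N]card_ord -card_prod.
apply: (indep_le_dim (b := fun t : 'I_(n i) * 'I_m => S i t.1 (e t.2)) hm').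
  move=> c c0 [j l]; apply: (ei (fun l => c (j, l))); apply: ell2P => w.
  have := congr1 (fun f : fock n dE => f (cons_word j w)) c0.
  rewrite /comb !fock_sum (eq_bigr (fun t : 'I_(n i) * 'I_m =>
    c (t.1, t.2) *: creation_fun t.1 (e t.2) (cons_word j w))); last by case.
  rewrite -(pair_bigA _ (fun j' l' =>
    c (j', l') *: creation_fun j' (e l') (cons_word j w))) /=.
  rewrite (bigD1 j)//= [X in _ + X]big1 ?addr0; last first.
    move=> j' j'j; rewrite big1// => l' _.
    rewrite /creation_fun cons_word_in; case: eqP => [jj'|_].
      by rewrite jj' eqxx in j'j.
    by rewrite scaler0.
  by move=> h; rewrite -[RHS]h; apply: eq_bigr => l' _; rewrite creation_fun_cons.
move=> [j l]; have [el Pel] : fock_ker q (e l) by rewrite -eN; exact: mem_comb.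
split; first exact: fock_le_creation qi ql el.
rewrite /= -(proj_creation cF invM) Pel.
by rewrite (linear_fun0 (creation_linear j)) (linear_fun0 (proj_linear M cF)).
Qed.

End CoinvariantRank.

(** * Limits of monotone functions of several integers *)

Section MonotoneLimits.
Context {R : realType}.

Definition tuple_mono k (u : k.-tuple nat -> R) : Prop :=
  forall q q' : k.-tuple nat,
    (forall i, (tnth q i <= tnth q' i)%N) -> u q <= u q'.

Lemma has_sup_range (T : Type) (t : T) (u : T -> R) B :
  (forall x, u x <= B) -> has_sup (range u).
Proof. by move=> uB; split; [exists (u t), t|exists B => _ [x _ <-]]. Qed.

Lemma sup_range_ge (T : Type) (u : T -> R) B x :
  (forall x, u x <= B) -> u x <= sup (range u).
Proof.
move=> uB; apply: sup_upper_bound; first exact: (has_sup_range x uB).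
by exists x.
Qed.

Lemma sup_range_le (T : Type) (t : T) (u : T -> R) B :
  (forall x, u x <= B) -> sup (range u) <= B.
Proof. by move=> uB; apply: ge_sup; [exists (u t), t|move=> _ [x _ <-]]. Qed.

Lemma cofinal_sup k (u : k.-tuple nat -> R) B (Q : nat -> k.-tuple nat) :
  tuple_mono u -> (forall q, u q <= B) -> increasing_cofinal Q ->
  u \o Q @ \oo --> sup (range u).
Proof.
move=> um uB [Qi Qc].
rewrite (_ : sup (range u) = sup (range (u \o Q))).
  apply: nondecreasing_cvgn.
    by apply/nondecreasing_seqP => m; apply: um => i; exact: Qi.
  by exists B => _ [m _ <-]; exact: uB.
apply/eqP; rewrite eq_le; apply/andP; split.
  apply: (sup_range_le [tuple of nseq k 0%N]) => q; have [m qm] := Qc q.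
  apply: le_trans (um q (Q m) qm) _.
  by apply: (@sup_range_ge _ (u \o Q) B m) => m' /=.
apply: (sup_range_le 0%N) => m /=.
exact: (sup_range_ge _ uB).
Qed.

(** The inner iterated limit for a fixed first variable p is given by the
    suprema over the remaining variables, and these suprema are again bounded
    and monotone in p. *)
Lemma mono_iter_lim k (u w : k.-tuple nat -> R) c B :
  tuple_mono u -> tuple_mono w -> (forall q, u q <= B) -> (forall q, w q <= B) ->
  (forall q, 1 <= w q) ->
  is_iter_lim (fun q => c - u q / w q) (c - sup (range u) / sup (range w)).
Proof.
elim: k u w => [|k IH] u w um wm uB wB w1.
  have sup0 (v : 0.-tuple nat -> R) : sup (range v) = v [tuple].
    rewrite (_ : range v = [set v [tuple]]) ?sup1//.
    by apply/seteqP; split=> [_ [t _ <-]|_ ->]; [rewrite (tuple0 t)|exists [tuple]].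
  by rewrite /= !sup0.
pose s (v : k.+1.-tuple nat -> R) (p : nat) :=
    fun t : k.-tuple nat => v [tuple of p :: t].
have smono v p : tuple_mono v -> tuple_mono (s v p).
  move=> vm q q' qq'; apply: vm => i.
  by case: (unliftP ord0 i) => [l ->|->]; rewrite ?tnthS ?tnth0.
have sup_cvg v : tuple_mono v -> (forall q, v q <= B) ->
    (fun p => sup (range (s v p))) @ \oo --> sup (range v).
  move=> vm vB; have sB p t : s v p t <= B by exact: vB.
  pose z := [tuple of nseq k 0%N].
  rewrite (_ : sup (range v) = sup (range (fun p => sup (range (s v p))))).
    apply: nondecreasing_cvgn; last first.
      by exists B => _ [p _ <-] /=; exact: (sup_range_le z (sB p)).
    apply/nondecreasing_seqP => p; apply: (sup_range_le z) => t.
    apply: le_trans (sup_range_ge t (sB p.+1)); apply: vm => i.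
    by case: (unliftP ord0 i) => [l ->|->]; rewrite ?tnthS ?tnth0.
  have supB p : sup (range (s v p)) <= B by exact: (sup_range_le z (sB p)).
  apply/eqP; rewrite eq_le; apply/andP; split.
    apply: (sup_range_le [tuple of nseq k.+1 0%N]) => q.
    case/tupleP: q => p t.
    exact: (le_trans (sup_range_ge t (sB p)) (sup_range_ge p supB)).
  apply: (sup_range_le 0%N) => p; apply: (sup_range_le z) => t.
  exact: (sup_range_ge _ vB).
exists (fun p => c - sup (range (s u p)) / sup (range (s w p))); split.
  by move=> p; apply: IH => [||t|t|t]; rewrite /s //; exact: smono.
have w0 : sup (range w) != 0.
  rewrite gt_eqF// (lt_le_trans ltr01)//.
  exact: (le_trans (w1 _) (sup_range_ge [tuple of nseq k.+1 0%N] wB)).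
apply: cvgB; first exact: cvg_cst.
by apply: cvgM; [exact: sup_cvg|apply: cvgV => //; exact: sup_cvg].
Qed.

Lemma tuple_mono_step k (u : k.-tuple nat -> R) :
  (forall q q' i, tnth q' i = (tnth q i).+1 ->
     (forall l, l != i -> tnth q' l = tnth q l) -> u q <= u q') ->
  tuple_mono u.
Proof.
move=> step q q'; move: {2}(\sum_(l < k) (tnth q' l - tnth q l))%N
  (leqnn (\sum_(l < k) (tnth q' l - tnth q l))) => N.
elim: N q => [|N IH] q sN qq'.
  suff -> : q = q' by [].
  apply: eq_from_tnth => l; apply/eqP; rewrite eqn_leq qq' /= -subn_eq0.
  by move: sN; rewrite leqn0 sum_nat_eq0 => /forallP/(_ l)/implyP ->.
have [/existsP [i qi]|/existsPn qN] := boolP [exists i, (tnth q i < tnth q' i)%N].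
  pose q1 := [tuple (if l == i then (tnth q l).+1 else tnth q l) | l < k].
  have q1i : tnth q1 i = (tnth q i).+1 by rewrite tnth_mktuple eqxx.
  have q1l l : l != i -> tnth q1 l = tnth q l.
    by move=> /negbTE li; rewrite tnth_mktuple li.
  apply: le_trans (step q q1 i q1i q1l) (IH _ _ _).
    rewrite -ltnS; apply: leq_trans sN.
    rewrite (bigD1 i)//= [X in (_ < X)%N](bigD1 i)//= q1i.
    rewrite (eq_bigr (fun l => tnth q' l - tnth q l)%N); last first.
      by move=> l li; rewrite q1l.
    by rewrite ltn_add2r ltn_sub2l.
  by move=> l; have [->|li] := eqVneq l i; rewrite ?q1i// q1l.
suff -> : q = q' by [].
by apply: eq_from_tnth => l; apply/eqP; rewrite eqn_leq qq' /= leqNgt qN.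
Qed.

End MonotoneLimits.

Section Growth.
Context {R : realType} {k : nat} {n : 'I_k -> nat}.
Context (n2 : forall i, (2 <= n i)%N).
Implicit Types q : k.-tuple nat.

(** The number of words of multi-length exactly q, the normalization for
    which the counting functions below become monotone. *)
Definition top_words q : nat := (\prod_(i < k) n i ^ tnth q i)%N.

Lemma top_words_gt0 q : (0 < top_words q)%N.
Proof. by apply: prodn_gt0 => i; rewrite expn_gt0 (leq_trans _ (n2 i)). Qed.

Lemma top_words_step q q' (i : 'I_k) :
  tnth q' i = (tnth q i).+1 -> (forall l, l != i -> tnth q' l = tnth q l) ->
  top_words q' = (n i * top_words q)%N.
Proof.
move=> qi ql; rewrite /top_words (bigD1 i)//= [in RHS](bigD1 i)//= qi expnS -mulnA.
by congr (_ * (_ * _))%N; apply: eq_bigr => l /ql ->.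
Qed.

Lemma nwords_step q q' (i : 'I_k) :
  tnth q' i = (tnth q i).+1 -> (forall l, l != i -> tnth q' l = tnth q l) ->
  (n i * nwords (n := n) q <= nwords (n := n) q')%N.
Proof.
move=> qi ql; rewrite /nwords (bigD1 i)//= [leqRHS](bigD1 i)//= qi mulnA.
apply: leq_mul.
  rewrite [leqRHS]big_ord_recl big_distrr /= -[leqLHS]add0n leq_add//.
  by apply: leq_sum => p _; rewrite -expnS.
by apply: leq_prod => l /ql ->.
Qed.

Lemma nwords_ge_top q : (top_words q <= nwords (n := n) q)%N.
Proof. by apply: leq_prod => i _; rewrite big_ord_recr /= leq_addl. Qed.

(** A geometric sum of ratio at least 2 is at most twice its last term. *)
Lemma nwords_le_top q : (nwords (n := n) q <= 2 ^ k * top_words q)%N.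
Proof.
rewrite -[k in (2 ^ k)%N]card_ord -prod_nat_const -big_split /=.
apply: leq_prod => i _; elim: (tnth q i) => [|p IH].
  by rewrite big_ord1 expn0.
rewrite big_ord_recr /=; apply: leq_trans (leq_add IH (leqnn _)) _.
rewrite mul2n -addnn mul2n -addnn leq_add2r addnn -mul2n expnS.
by rewrite leq_mul2r n2 orbT.
Qed.

Lemma ratio_mono (f : k.-tuple nat -> nat) :
  (forall q q' i, tnth q' i = (tnth q i).+1 ->
     (forall l, l != i -> tnth q' l = tnth q l) -> (n i * f q <= f q')%N) ->
  tuple_mono (fun q => (f q)%:R / (top_words q)%:R : R).
Proof.
move=> step; apply: tuple_mono_step => q q' i qi ql.
rewrite ler_pdivrMr ?ltr0n ?top_words_gt0// mulrAC.
rewrite ler_pdivlMr ?ltr0n ?top_words_gt0// -!natrM ler_nat.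
rewrite (top_words_step qi ql) mulnCA mulnA; apply: leq_mul => //.
exact: (step _ _ _ qi ql).
Qed.

End Growth.

(** * The Euler characteristic *)

Lemma vbasis_indep (R : realType) (V : vectType R[i]) :
  indep (fun i : 'I_(\dim {:V}) => (vbasis {:V})`_i).
Proof.
move=> c c0; have /freeP := basis_free (vbasisP {:V}).
by apply.
Qed.

Lemma vbasis_span (R : realType) (V : vectType R[i]) :
  [set: V] `<=` range (comb (fun i : 'I_(\dim {:V}) => (vbasis {:V})`_i)).
Proof.
move=> x _; exists (fun i => coord (vbasis {:V}) i x) => //.
by rewrite [RHS](coord_vbasis (memvf x)).
Qed.

Lemma op_rank_Ple_scalar (R : realType) (k : nat) (n : 'I_k -> nat)
    (q : k.-tuple nat) :
  op_rank (Ple (n := n) (cdot R) q) = nwords (n := n) q.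
Proof.
pose one (_ : unit) : R[i]^o := 1.
have oneE c : comb one c = c tt.
  by rewrite /comb (big_pred1 tt) => [|[]//]; exact: mulr1.
rewrite (@op_rank_Ple _ _ _ n (cdot R) unit one) ?card_unit ?muln1//.
  by move=> c; rewrite oneE => c0 [].
by move=> z _; exists (fun=> z); rewrite // oneE.
Qed.

Theorem theorem2p4 (R : realType) (k : nat) (n : 'I_k -> nat)
    (E : vectType R[i]) (dE : {dot E for Num.conj}) (M : set (fock n dE)) :
  (0 < k)%N -> (forall i, (2 <= n i)%N) ->
  closed_subspace (fock_dot n dE) M -> creation_invariant M ->
  exists chi : R,
    is_iter_lim
      (fun q : k.-tuple nat =>
         (op_rank (oproj (fock_dot n dE) [set` orthc (fock_dot n dE) M]
                  \o Ple dE q))%:R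
         / (op_rank (Ple (n := n) (cdot R) q))%:R)
      chi
    /\ is_euler_char (n := n) (orth_dot (fock_dot n dE) M)
         (fun i j => compress (fock_dot n dE) M (creation dE i j)) chi.
Proof.
move=> _ n2 _ invM.
pose b := fun i : 'I_(\dim {:E}) => (vbasis {:E})`_i.
have bi : indep b := @vbasis_indep R E.
have bT : setT `<=` range (comb b) := @vbasis_span R E.
pose e := #|'I_(\dim {:E})|.
have [m mE] := choice (fock_ker_fin M bT).
pose u q : R := (m q)%:R / (top_words (n := n) q)%:R.
pose w q : R := (nwords (n := n) q)%:R / (top_words (n := n) q)%:R.
have D0 q : 0 < (top_words (n := n) q)%:R :> R by rewrite ltr0n top_words_gt0.
have N0 q : (nwords (n := n) q)%:R != 0 :> R.
  by rewrite pnatr_eq0 -lt0n (leq_trans (top_words_gt0 n2 q))// nwords_ge_top.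
have mN q : (m q <= nwords (n := n) q * e)%N.
  have [c [ci cN]] := has_dim_basis (mE q).
  rewrite -[X in (X <= _)%N]card_ord.
  apply: indep_le_dim (fock_le_dim dE bi bT q) ci _ => t.
  by have [] : fock_ker M q (c t) by rewrite -cN; exact: mem_comb.
have ratio q : (nwords (n := n) q * e - m q)%:R / (nwords (n := n) q)%:R =
    e%:R - u q / w q :> R.
  rewrite natrB// natrM mulrBl mulrAC mulfV// mul1r; congr (_ - _).
  by rewrite /u /w invf_div mulrA divfK// gt_eqF.
have um : tuple_mono u.
  apply: (ratio_mono n2) => q q' i qi ql.
  exact: (fock_ker_growth bT invM qi ql (mE q) (mE q')).
have wm : tuple_mono w by apply: (ratio_mono n2); exact: nwords_step.
have w1 q : 1 <= w q.
  by rewrite /w ler_pdivlMr// mul1r ler_nat; exact: nwords_ge_top.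
(* A common bound: w <= 2^k, and u <= e w since m <= e N. *)
pose B : R := (2 ^ k)%:R * (e.+1)%:R.
have uB q : u q <= B.
  rewrite /u ler_pdivrMr// /B -!natrM ler_nat; apply: leq_trans (mN q) _.
  by rewrite mulnAC; apply: leq_mul => //; exact: nwords_le_top.
have wB q : w q <= B.
  rewrite /w ler_pdivrMr// /B -!natrM ler_nat.
  rewrite mulnAC; apply: leq_trans (nwords_le_top n2 q) _.
  by rewrite leq_pmulr.
exists (e%:R - sup (range u) / sup (range w)); split.
  rewrite (_ : (fun q => _) = fun q => e%:R - u q / w q).
    exact: mono_iter_lim um wm uB wB w1.
  apply/funext => q; rewrite -ratio op_rank_Ple_scalar.
  by rewrite (rank_proj_Ple bi bT (mE q)).
have cF : hcomplete (fock_dot n dE) := fock_complete bT.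
split.
- by apply: hcomplete_hilbert; exact: orth_complete.
- by move=> i j; exact: compress_bounded.
- by move=> s t i j st; exact: compress_comm.
- exact: (finite_rank_defect bT invM).
move=> Q cQ; rewrite (_ : (fun p => _) = fun p => e%:R - u (Q p) / w (Q p)).
  apply: cvgB; first exact: cvg_cst.
  apply: cvgM; first exact: (cofinal_sup um uB cQ).
  apply: cvgV; last exact: (cofinal_sup wm wB cQ).
  rewrite gt_eqF// (lt_le_trans ltr01)//.
  exact: (le_trans (w1 (Q 0%N)) (sup_range_ge (Q 0%N) wB)).
apply/funext => p; rewrite -ratio (dim_Mspace bi bT invM (mE (Q p))).
congr (_ / _); rewrite /nwords natr_prod; apply: eq_bigr => i _.
by rewrite natr_sum; apply: eq_bigr => l _; rewrite natrX.
Qed.
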